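(* Let $\mathbf F$ be a Fraïssé structure, let $G=\mathrm{Aut}(\mathbf F)$, and let $\mathcal X$ be a class of $G$-flows such that the class of $\mathcal X$-$G$-ambits is closed under suprema and factors, and such that every $G\curvearrowright X$ in $\mathcal X$ admits some $x\in X$ such that the flow $G\curvearrowright\overline{G\cdot x}$ is in $\mathcal X$. Then $$\mathcal A:=\{f\in \mathrm{RUC}_b(G) : \text{the flow } G\curvearrowright \overline{G\bullet f}\text{ is in }\mathcal X\}$$ is a unital, left-invariant, closed C$^*$-subalgebra of $\mathrm{RUC}_b(G)$, and the following are equivalent: (i) Every $G$-flow in $\mathcal X$ has a fixed point. (ii) For every $\varepsilon>0$, $\mathbf F$ has the Ramsey property up to $2\varepsilon$ for the finite colorings in $(\mathcal A)_\varepsilon$. Those imply the following two statements, which are equivalent to each other: (iii) Every zero-dimensional $G$-flow in $\mathcal X$ has a fixed point. (iv) $\mathbf F$ has the Ramsey property for the finite colorings in $\mathcal A$. When the finite colorings (belonging to $\mathcal A$) are norm-dense in $\mathcal A$, all four statements (i)–(iv) are equivalent.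
   Context: Structures. Languages are first-order and relational; a structure is a non-empty set with interpretations of the relation symbols. An embedding is an isomorphism onto its image (an induced substructure); $\binom{\mathbf B}{\mathbf A}$ denotes the set of all embeddings of $\mathbf A$ into $\mathbf B$. A Fraïssé structure is a countable ultrahomogeneous structure, i.e. every isomorphism between finite substructures extends to an automorphism. $\mathrm{Age}(\mathbf F)$ is the set of all finite substructures of $\mathbf F$. $\mathrm{Aut}(\mathbf F)$ is a topological group for which the pointwise stabilizers $\mathrm{Stab}(\mathbf A)$ of finite substructures $\mathbf A$ form a basis of neighborhoods of the identity. Flows. A $G$-flow is a continuous left action $G\curvearrowright X$ on a (non-empty) compact Hausdorff space. A $G$-ambit $(X,x)$ is a $G$-flow with a distinguished point $x$ whose orbit is dense. An $\mathcal X$-$G$-ambit is a $G$-ambit whose underlying flow is in $\mathcal X$. A factor of the ambit $(X,x)$ is an ambit $(Y,y)$ for which there is a continuous $G$-equivariant map $X\to Y$ sending $x$ to $y$. The supremum of a family $(X_\alpha,x_\alpha)_\alpha$ of ambits is the ambit on the orbit closure of $(x_\alpha)_\alpha$ in $\prod_\alpha X_\alpha$, with distinguished point $(x_\alpha)_\alpha$. A flow is zero-dimensional when its underlying space is. Functions. $\mathrm{RUC}_b(G)$ is the C$^*$-algebra (supremum norm) of bounded right-uniformly continuous functions $f:G\to\mathbb C$: for every $\varepsilon>0$ there is a neighborhood $U$ of the identity such that $gh^{-1}\in U$ implies $|f(g)-f(h)|<\varepsilon$. $G$ acts on it by $g\cdot f(h)=f(g^{-1}h)$ (left shift) and by $g\bullet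 f(h)=f(hg)$ (right shift). A subalgebra is left-invariant when invariant under left shift. $\overline{G\bullet f}$ is the closure of $\{g\bullet f:g\in G\}$ in $\mathrm{RUC}_b(G)$ for the topology of pointwise convergence; it is compact and the right shift action on it is continuous, so it is a $G$-flow. For $\mathcal A\subset \mathrm{RUC}_b(G)$, $(\mathcal A)_\varepsilon$ is the set of $f\in\mathrm{RUC}_b(G)$ with $\|f-\alpha\|_\infty<\varepsilon$ for some $\alpha\in\mathcal A$. Colorings. For a finite substructure $\mathbf A\subset\mathbf F$, a coloring of $\binom{\mathbf F}{\mathbf A}$ is a map $\bar\chi:\binom{\mathbf F}{\mathbf A}\to\mathbb C$; it is identified with the function $\chi\in\mathrm{RUC}_b(G)$, $\chi(g)=\bar\chi(g^{-1}\upharpoonright A)$ (bounded colorings are considered). It is finite when its range is finite. For $\mathcal F\subset \mathrm{RUC}_b(G)$ and $\varepsilon>0$, $\mathbf F$ has the Ramsey property (resp. Ramsey property up to $\varepsilon$) for colorings in $\mathcal F$ when for all $\mathbf A,\mathbf B\in\mathrm{Age}(\mathbf F)$ and every finite set $\mathcal C\subset\mathcal F$ of finite colorings of $\binom{\mathbf F}{\mathbf A}$, there is $b\in\binom{\mathbf F}{\mathbf B}$ such that every $\chi\in\mathcal C$ is constant (resp. constant up to $\varepsilon$, i.e. any two values differ by less than $\varepsilon$ in modulus) on $\binom{b(\mathbf B)}{\mathbf A}$. *)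

(* Defs.v *)
From HB Require Import structures.
From mathcomp Require Import all_boot all_order all_algebra.
From mathcomp Require Import complex.
From mathcomp Require Import all_classical all_reals all_analysis.
From mathcomp Require Import ring lra.

Set Implicit Arguments.
Unset Strict Implicit.
Unset Printing Implicit Defensive.

Import Order.TTheory GRing.Theory Num.Theory.
Import numFieldNormedType.Exports.
Import ComplexField.Normc.

Local Open Scope classical_set_scope.
Local Open Scope ring_scope.

(** * Topological groups and flows *)

HB.mixin Record isTopologicalGroup G & Group G & Topological G := {
  mulg_continuous : continuous (fun p : G * G => (p.1 * p.2)%g);
  invg_continuous : continuous (fun g : G => (g^-1)%g)
}.

#[short(type="topGroupType")]
HB.structure Definition TopGroup :=
  {G of isTopologicalGroup G & Group G & Topological G}.

Record flow (G : topGroupType) := Flow {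
  flow_space :> topologicalType;
  flow_act : G -> flow_space -> flow_space;
  flow_inhabited : inhabited flow_space;
  flow_compact : compact [set: flow_space];
  flow_hausdorff : hausdorff_space flow_space;
  flow_act1 : forall x, flow_act 1%g x = x;
  flow_actM : forall g h x, flow_act (g * h)%g x = flow_act g (flow_act h x);
  flow_act_continuous : continuous (fun p : G * flow_space => flow_act p.1 p.2)
}.

(* the norm topology on the complex numbers *)
HB.instance Definition _ (R : realType) :=
  NormedModule.copy R[i] ((R[i] : numFieldType)^o).

Section Flows.
Context {G : topGroupType}.
Implicit Type X : flow G.

Definition flow_orbit X (x : X) : set X := range (fun g => flow_act g x).

(* The restriction of an action on [T] to an invariant compact set [K], with
   the subspace topology. Only the restricted action has to be jointly
   continuous: right shift is not, on the space of all functions on [G]. *)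
Section Subflow.
Context (T : topologicalType) (a : G -> T -> T) (K : set T).
Hypotheses (K0 : K !=set0) (Kco : compact K) (HT : hausdorff_space T).
Hypothesis Ka : forall g x, K x -> K (a g x).
Hypotheses (a1 : forall x, a 1%g x = x)
           (aM : forall g h x, a (g * h)%g x = a g (a h x)).
Hypothesis acont : forall g x, K x -> forall W, nbhs (a g x) W ->
  exists U V, [/\ nbhs g U, nbhs x V &
                  forall h y, U h -> V y -> K y -> W (a h y)].

Lemma set_type_continuous : continuous (set_val : K -> T).
Proof. exact: (@initial_continuous K T set_val). Qed.

Lemma nbhs_set_type (x : K) (W : set K) : nbhs x W <->
  exists2 V, nbhs (set_val x) V & set_val @^-1` V `<=` W.
Proof.
split=> [[B [[V oV <-] Vx] BW]|[V Vx VW]].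
  by exists V => //; exact: open_nbhs_nbhs.
by apply: filterS VW _; exact: set_type_continuous.
Qed.

Definition subact (g : G) (x : K) : K :=
  exist _ (a g (val x)) (mem_set (Ka g (set_mem (valP x)))).

Lemma subflow_inhabited : inhabited K.
Proof. by case: K0 => x Kx; exists; exact: (exist _ x (mem_set Kx)). Qed.

Lemma subflow_compact : compact [set: K].
Proof.
move=> F FF _.
have FK : (set_val @ F) K.
  by apply: (@filterS _ F _ setT) => [x _|]; [exact: set_valP|exact: filterT].
have [x [Kx clx]] := Kco (fmap_proper_filter set_val FF) FK.
 exists (exist _ x (mem_set Kx)); split => // A B FA.
move=> /nbhs_set_type[V Vx VB].
have FA' : (set_val @ F) (set_val @` A) by apply: (@filterS _ F _ A) => // y Ay; exists y.
have [_ [[y Ay <-] Vy]] := clx _ _ FA' Vx.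
by exists y; split => //; exact: VB.
Qed.

Lemma subflow_hausdorff : hausdorff_space K.
Proof.
move=> x y xy; apply: val_inj; apply: HT => A B Ax By.
have [z [Az Bz]] := xy _ _ (set_type_continuous Ax) (set_type_continuous By).
by exists (set_val z).
Qed.

Lemma subact1 x : subact 1%g x = x.
Proof. exact/val_inj/a1. Qed.

Lemma subactM g h x : subact (g * h)%g x = subact g (subact h x).
Proof. exact/val_inj/aM. Qed.

Lemma subact_continuous : continuous (fun p : G * K => subact p.1 p.2).
Proof.
move=> [g x] W /nbhs_set_type[V Vx VW].
have [U [V' [Ug V'x UV]]] := acont (set_mem (valP x)) Vx.
exists (U, set_val @^-1` V') => /=.
  by split => //; exact: set_type_continuous.
move=> [h y] [/= Uh Vy]; apply: VW.
exact: (UV h (val y) Uh Vy (set_mem (valP y))).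
Qed.

Definition subflow : flow G :=
  Flow subflow_inhabited subflow_compact subflow_hausdorff subact1 subactM
       subact_continuous.

End Subflow.

Lemma act_cont_r X (g : G) : continuous (flow_act g : X -> X).
Proof.
move=> x W Wx; have [[U V] /= [Ug Vx] UV] := @flow_act_continuous _ X (g, x) W Wx.
apply: filterS Vx => y Vy; apply: (UV (g, y)); split => //=.
exact: nbhs_singleton.
Qed.

Lemma closure_inv (T : topologicalType) (f : T -> T) (A : set T) :
  continuous f -> (forall x, A x -> A (f x)) ->
  forall x, closure A x -> closure A (f x).
Proof.
move=> fc Af x Ax B /fc /Ax[y [Ay By]].
by exists (f y); split => //; exact: Af.
Qed.

Section OrbitClosure.
Variables (X : flow G) (x : X).

Lemma orbit_self : flow_orbit x x.
Proof. by exists 1%g => //; rewrite flow_act1. Qed.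

Lemma orbit_act g y : flow_orbit x y -> flow_orbit x (flow_act g y).
Proof. by move=> [h _ <-]; exists (g * h)%g => //; rewrite flow_actM. Qed.

Lemma orbit_closure_neq0 : closure (flow_orbit x) !=set0.
Proof. by exists x; exact: subset_closure orbit_self. Qed.

Lemma orbit_closure_compact : compact (closure (flow_orbit x)).
Proof.
by apply: subclosed_compact (@flow_compact _ X) _ => //; exact: closed_closure.
Qed.

Lemma orbit_closure_act g y :
  closure (flow_orbit x) y -> closure (flow_orbit x) (flow_act g y).
Proof. by apply: closure_inv; [exact: act_cont_r|exact: orbit_act]. Qed.

Lemma orbit_closure_act_cont g y : closure (flow_orbit x) y ->
  forall W, nbhs (flow_act g y) W ->
  exists U V, [/\ nbhs g U, nbhs y V &
    forall h z, U h -> V z -> closure (flow_orbit x) z -> W (flow_act h z)].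
Proof.
move=> _ W Wy; have [[U V] /= [Ug Vx] UV] := @flow_act_continuous _ X (g, y) W Wy.
by exists U, V; split => // h z Uh Vz _; exact: (UV (h, z)).
Qed.

Definition orbit_closure_flow : flow G :=
  subflow orbit_closure_neq0 orbit_closure_compact (@flow_hausdorff _ X)
    orbit_closure_act (@flow_act1 _ X) (@flow_actM _ X) orbit_closure_act_cont.

Definition orbit_closure_pt : orbit_closure_flow :=
  exist _ x (mem_set (subset_closure orbit_self)).

Lemma orbit_closure_dense :
  closure (flow_orbit orbit_closure_pt) = [set: orbit_closure_flow].
Proof.
apply/seteqP; split => // y _ W /nbhs_set_type[V Vy VW].
have [_ [[g _ <-] Vz]] := set_mem (valP y) V Vy.
by exists (flow_act g orbit_closure_pt); split; [exists g|apply: VW].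
Qed.

End OrbitClosure.

Record ambit := Ambit {
  ambit_flow :> flow G;
  ambit_pt : ambit_flow;
  ambit_dense : closure (flow_orbit ambit_pt) = [set: ambit_flow]
}.

Definition is_factor (Y X : ambit) : Prop :=
  exists phi : X -> Y,
    [/\ continuous phi, forall g x, phi (flow_act g x) = flow_act g (phi x) &
        phi (ambit_pt X) = ambit_pt Y].


Lemma prod_cvg (I : Type) (T : I -> topologicalType)
    (F : set_system (prod_topology T)) (x : prod_topology T) :
  Filter F -> (forall i, (fun y : prod_topology T => y i) @ F --> x i) -> F --> x.
Proof.
move=> FF Fx; apply/cvg_sup => i W [_ [[V oV <-] Vx] VW].
by apply: filterS VW _; apply: Fx; exact: open_nbhs_nbhs.
Qed.

Lemma prod_proj_continuous (I : Type) (T : I -> topologicalType) (i : I) :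
  continuous (fun y : prod_topology T => y i).
Proof. exact: (@proj_continuous {classic I} T i). Qed.

Section Product.
Variables (I : Type) (X : I -> flow G).

Let P : topologicalType := prod_topology (fun i => X i : topologicalType).

Definition prod_act (g : G) (x : P) : P := fun i => flow_act g (x i).

Lemma prod_inhabited : inhabited P.
Proof.
have X0 i : exists _ : X i, True by case: (flow_inhabited (X i)) => x; exists x.
exact: (inhabits (fun i => projT1 (cid (X0 i)))).
Qed.

Lemma prod_compact : compact [set: P].
Proof.
have := @tychonoff {classic I} (fun i => X i) (fun i => setT)
  (fun i => @flow_compact _ (X i)).
by congr compact; apply/seteqP.
Qed.

Lemma prod_hausdorff : hausdorff_space P.
Proof.
exact: (@hausdorff_product {classic I} (fun i => X i) (fun i => @flow_hausdorff _ (X i))).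
Qed.

Lemma prod_act1 x : prod_act 1%g x = x.
Proof. by apply: functional_extensionality_dep => i; exact: flow_act1. Qed.

Lemma prod_actM g h x : prod_act (g * h)%g x = prod_act g (prod_act h x).
Proof. by apply: functional_extensionality_dep => i; exact: flow_actM. Qed.

Lemma prod_act_continuous : continuous (fun p : G * P => prod_act p.1 p.2).
Proof.
move=> [g x]; apply: prod_cvg => i W Wx.
have [[U V] /= [Ug Vx] UV] := @flow_act_continuous _ (X i) (g, x i) W Wx.
exists (U, (fun y : P => y i) @^-1` V) => /=.
  by split => //; exact: prod_proj_continuous.
by move=> [h y] [/= Uh Vy]; exact: (UV (h, y i)).
Qed.

Definition prod_flow : flow G :=
  Flow prod_inhabited prod_compact prod_hausdorff prod_act1 prod_actM
       prod_act_continuous.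

End Product.

Definition orbit_ambit (X : flow G) (x : X) : ambit :=
  Ambit (orbit_closure_dense x).

Definition sup_ambit (I : Type) (X : I -> ambit) : ambit :=
  @orbit_ambit (prod_flow (fun i => X i)) (fun i => ambit_pt (X i)).

End Flows.

Section RUC.
Context {R : realType} {G : topGroupType}.
Implicit Type f : G -> R[i].

Definition RUCb f : Prop :=
  (exists M : R, forall g, normc (f g) <= M) /\
  (forall e : R, 0 < e -> exists2 U : set G, nbhs 1%g U &
     forall g h, U (g * h^-1)%g -> normc (f g - f h) < e).

Definition supnorm f : R := sup (range (fun g => normc (f g))).

Definition left_shift (g : G) f : G -> R[i] := fun h => f (g^-1 * h)%g.
Definition right_shift (g : G) f : G -> R[i] := fun h => f (h * g)%g.

Definition rorbit f : set {ptws G -> R[i]} := range (fun g => right_shift g f).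

Lemma normcB_sym (z w : R[i]) : normc (z - w) = normc (w - z).
Proof. by rewrite -normcN opprB. Qed.

Lemma nbhs_normcP (z : R[i]) (W : set R[i]) : nbhs z W <->
  exists2 e : R, 0 < e & forall w, normc (z - w) < e -> W w.
Proof.
split.
  move/nbhs_ballP => [[e e'] /=]; rewrite ltcE /= => /andP[/eqP -> e0] eW.
  exists e => // w zw; apply: eW; rewrite /ball /= normc_def.
  by rewrite -/(real_complex R e) ltcR; case: (z - w) zw.
move=> [e e0 eW]; apply/nbhs_ballP; exists e%:C%C => /=; first by rewrite ltcR.
move=> w; rewrite /ball /= normc_def ltcR => zw; apply: eW.
by case: (z - w) zw.
Qed.

Lemma normc_triangle (z w v : R[i]) :
  normc (z - v) <= normc (z - w) + normc (w - v).
Proof. by rewrite -[z - v](subrKA w) le_normcD. Qed.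

Lemma mulg_continuous_l (c : G) : continuous (fun k : G => c * k)%g.
Proof.
move=> k W Wk; have [[U V] /= [Uc Vk] UV] := @mulg_continuous G (c, k) W Wk.
by apply: filterS Vk => y Vy; apply: (UV (c, y)); split => //=; exact: nbhs_singleton.
Qed.

Lemma mulg_continuous_r (c : G) : continuous (fun k : G => k * c)%g.
Proof.
move=> k W Wk; have [[U V] /= [Uk Vc] UV] := @mulg_continuous G (k, c) W Wk.
by apply: filterS Uk => y Uy; apply: (UV (y, c)); split => //=; exact: nbhs_singleton.
Qed.

Lemma Complex_continuous : continuous (fun p : R * R => p.1 +i* p.2)%C.
Proof.
move=> [x y] W /nbhs_normcP[e e0 eW].
have e20 : 0 < e / 2 by rewrite divr_gt0.
exists (ball x (e / 2), ball y (e / 2)) => /=.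
  by split; exact: nbhsx_ballx.
move=> [x' y'] [/= xx' yy']; apply: eW.
have -> : ((x +i* y) - (x' +i* y') = (x - x')%:C + (y - y') *i)%C.
  by apply/eqP; rewrite eq_complex /= addr0 add0r !eqxx.
apply: le_lt_trans (le_normcD _ _) _.
rewrite (splitr e) ltrD //= expr0n/= ?addr0 ?add0r sqrtr_sqr //.
Qed.

Lemma square_compact (M : R) :
  compact [set z : R[i] | `|complex.Re z| <= M /\ `|complex.Im z| <= M].
Proof.
have := continuous_compact (continuous_subspaceT Complex_continuous)
  (compact_setX (@segment_compact R (- M) M) (@segment_compact R (- M) M)).
congr compact; apply/seteqP; split=> [_ [[x y] /= [+ +] <-]|[x y] /= [xM yM]].
  by rewrite /= !in_itv /= -!ler_norml.
by exists (x, y) => //; rewrite /= !in_itv /= -!ler_norml.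
Qed.

Lemma ptws_hausdorff : hausdorff_space {ptws G -> R[i]}.
Proof.
apply: (@hausdorff_product {classic G} (fun=> R[i])) => _.
exact: norm_hausdorff.
Qed.

Lemma ptws_nbhs (phi : {ptws G -> R[i]}) h (e : R) : 0 < e ->
  nbhs phi [set psi : {ptws G -> R[i]} | normc (phi h - psi h) < e].
Proof.
move=> e0.
have: nbhs (phi h) [set z | normc (phi h - z) < e] by apply/nbhs_normcP; exists e.
exact: (@prod_proj_continuous G (fun=> R[i]) h phi).
Qed.

Lemma right_shift1 f : right_shift 1%g f = f.
Proof. by apply/funext => h; rewrite /right_shift mulg1. Qed.

Lemma right_shiftM g k f : right_shift (g * k)%g f = right_shift g (right_shift k f).
Proof. by apply/funext => h; rewrite /right_shift mulgA. Qed.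

Lemma rorbit_self f : rorbit f f.
Proof. by exists 1%g => //; rewrite right_shift1. Qed.

Lemma rorbit_closure_neq0 f : closure (rorbit f) !=set0.
Proof. by exists f; exact: subset_closure (rorbit_self f). Qed.

Lemma ptws_cvg (F : set_system {ptws G -> R[i]}) (x : {ptws G -> R[i]}) :
  Filter F ->
  (forall (h : G) W, nbhs (x h) W ->
     F ((fun y : {ptws G -> R[i]} => y h) @^-1` W)) ->
  forall W, nbhs x W -> F W.
Proof.
move=> FF Fx W Wx. 
have := @prod_cvg G (fun=> R[i]) F x FF Fx W Wx.
exact.
Qed.

Lemma ptws_continuous (T : topologicalType) (k : T -> {ptws G -> R[i]}) (x : T) :
  (forall h : G, {for x, continuous (fun t => k t h)}) -> {for x, continuous k}.
Proof.
move=> kx.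
have FF : Filter (k @ nbhs x) by exact: fmap_filter.
have H := @ptws_cvg (k @ nbhs x) (k x) FF.
apply: H.
exact: kx.
Qed.

Lemma rshift_continuous g :
  continuous (right_shift g : {ptws G -> R[i]} -> {ptws G -> R[i]}).
Proof.
move=> phi; apply: ptws_continuous => h W Wx.
exact: (@prod_proj_continuous G (fun=> R[i]) (h * g)%g phi W Wx).
Qed.

Lemma rorbit_closure_act f g phi :
  closure (rorbit f) phi -> closure (rorbit f) (right_shift g phi).
Proof.
apply: closure_inv; first exact: rshift_continuous.
by move=> _ [h _ <-]; exists (g * h)%g => //; rewrite right_shiftM.
Qed.

Lemma rorbit_closure_compact f : RUCb f -> compact (closure (rorbit f)).
Proof.
move=> [[M fM] _].
pose S := [set z : R[i] | `|complex.Re z| <= M /\ `|complex.Im z| <= M].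
pose P : set {ptws G -> R[i]} := [set phi | forall h, S (phi h)].
have Pco : compact P.
  apply: (@tychonoff {classic G} (fun=> R[i]) (fun=> S)) => _.
  exact: square_compact.
apply: (subclosed_compact _ Pco); first exact: closed_closure.
have /closure_id -> : closed P by exact: compact_closed ptws_hausdorff Pco.
apply: closureS => _ [g _ <-] h; rewrite /right_shift.
have := fM (h * g)%g; case: (f _) => x y /= xyM.
by split; apply: le_trans xyM; rewrite -sqrtr_sqr ler_sqrt ?addr_ge0 ?sqr_ge0//;
  rewrite ?lerDl ?lerDr sqr_ge0.
Qed.

Lemma rorbit_closure_modulus f (e : R) (U : set G) : 0 < e ->
  (forall g h, U (g * h^-1)%g -> normc (f g - f h) < e) ->
  forall phi, closure (rorbit f) phi ->
  forall g h, U (g * h^-1)%g -> normc (phi g - phi h) < e + e + e.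
Proof.
move=> e0 fU phi fphi g h Ugh.
have [_ [[k _ <-] [phig phih]]] :=
  fphi _ (filterI (ptws_nbhs phi g e0) (ptws_nbhs phi h e0)).
move: phig phih; rewrite /= /right_shift => phig phih.
apply: le_lt_trans (normc_triangle _ (f (h * k)%g) _) _.
rewrite ltrD //; last by rewrite normcB_sym.
apply: le_lt_trans (normc_triangle _ (f (g * k)%g) _) _.
by rewrite ltrD //; apply: fU; rewrite invgM mulgA mulgK.
Qed.

Lemma rorbit_closure_act_cont f : RUCb f -> forall g phi,
  closure (rorbit f) phi ->
  forall W : set {ptws G -> R[i]}, nbhs (right_shift g phi : {ptws G -> R[i]}) W ->
  exists U V, [/\ nbhs g U, nbhs (phi : {ptws G -> R[i]}) V &
    forall h psi, U h -> V psi -> closure (rorbit f) psi -> W (right_shift h psi)].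
Proof.
move=> [_ ucf] g phi Kphi W Wphi.
pose F : set_system {ptws G -> R[i]} := fun W => exists U V,
  [/\ nbhs g U, nbhs (phi : {ptws G -> R[i]}) V &
    forall h psi, U h -> V psi -> closure (rorbit f) psi -> W (right_shift h psi)].
have FF : Filter F.
  split=> [|A B [U [V [gU pV UV]]] [U' [V' [gU' pV' UV']]]|A B AB].
  - by exists setT, setT; split => //; exact: filterT.
  - exists (U `&` U'), (V `&` V'); split; [exact: filterI|exact: filterI|].
    by move=> h psi [Uh Uh'] [Vp Vp'] K; split; [exact: UV|exact: UV'].
  - by move=> [U [V [gU pV UV]]]; exists U, V; split => // h psi Uh Vp K; exact/AB/UV.
have H := @ptws_cvg F (right_shift g phi) FF.
apply: (H _ W Wphi) => h {Wphi H}W /nbhs_normcP[e e0 eW].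
pose d := e / 4; have d0 : 0 < d by rewrite divr_gt0.
have [U U1 fU] := ucf d d0.
exists [set k | U (h * k * (h * g)^-1)%g],
       [set psi : {ptws G -> R[i]} | normc (phi (h * g)%g - psi (h * g)%g) < d].
split; [|exact: ptws_nbhs|].
  have cont : continuous (fun k : G => (h * k * (h * g)^-1)%g).
    move=> k; apply: (@continuous_comp _ _ _ (fun k => h * k)%g (fun k => k * (h * g)^-1)%g).
      exact: mulg_continuous_l.
    exact: mulg_continuous_r.
  by apply: cont; rewrite mulgV.
move=> k psi /= Uk Vpsi Kpsi; apply: eW; rewrite /right_shift.
apply: le_lt_trans (normc_triangle _ (psi (h * g)%g) _) _.
have -> : e = d + (d + d + d) by rewrite /d; field.
rewrite ltrD // normcB_sym.
exact: (rorbit_closure_modulus d0 fU Kpsi).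
Qed.

(* Hence the closure of the right translates of [f] in all of [G -> R[i]] is
   also their closure in the space of bounded right-uniformly continuous
   functions. *)
Lemma rorbit_closure_RUCb f : RUCb f -> closure (rorbit f) `<=` RUCb.
Proof.
move=> [[M fM] ucf] phi Kphi; split.
  exists (1 + M) => g.
  have [_ [[k _ <-] /= pg]] := Kphi _ (ptws_nbhs phi g ltr01).
  rewrite -[phi g]subr0 (le_trans (normc_triangle _ (f (g * k)%g) _)) //.
  by rewrite lerD ?(ltW pg) // subr0.
move=> e e0; have d0 : 0 < e / 3 by rewrite divr_gt0.
have [U U1 fU] := ucf _ d0; exists U => // g h Ugh.
have -> : e = e / 3 + e / 3 + e / 3 by field.
exact: (rorbit_closure_modulus d0 fU Kphi).
Qed.

Definition right_shift_flow f (hf : RUCb f) : flow G :=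
  subflow (rorbit_closure_neq0 f) (rorbit_closure_compact hf) ptws_hausdorff
    (rorbit_closure_act (f := f)) right_shift1 right_shiftM (rorbit_closure_act_cont hf).
End RUC.

Section Classes.
Context {R : realType} {G : topGroupType}.

(* As the family may be empty, the one-point ambit belongs to any class of
   ambits closed under suprema. *)
Definition closed_under_suprema (X : flow G -> Prop) : Prop :=
  forall (I : Type) (a : I -> ambit), (forall i, X (a i)) -> X (sup_ambit a).

Definition closed_under_factors (X : flow G -> Prop) : Prop :=
  forall a b : ambit, X a -> is_factor b a -> X b.

Definition has_fixed_point (X : flow G) : Prop :=
  exists x : X, forall g, flow_act g x = x.

(* The library's [zero_dimensional] only asks for clopen sets to separate
   points. *)
Definition has_clopen_basis (X : flow G) : Prop := basis (@clopen X).

Definition flow_algebra (X : flow G -> Prop) : set (G -> R[i]) :=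
  [set f | exists hf : RUCb f, X (right_shift_flow hf)].

Definition fattening (S : set (G -> R[i])) (e : R) : set (G -> R[i]) :=
  [set f | RUCb f /\ exists2 a, S a & supnorm (fun g => f g - a g) < e].

Record unital_left_invariant_closed_subCstar (S : set (G -> R[i])) : Prop := {
  subCstar_RUCb : S `<=` RUCb;
  subCstar_one : S (fun=> 1);
  subCstar_add : forall f h, S f -> S h -> S (fun g => f g + h g);
  subCstar_scale : forall (z : R[i]) f, S f -> S (fun g => z * f g);
  subCstar_mul : forall f h, S f -> S h -> S (fun g => f g * h g);
  subCstar_conj : forall f, S f -> S (fun g => conjc (f g));
  subCstar_left_shift : forall k f, S f -> S (left_shift k f);
  subCstar_closed : forall f, RUCb f ->
    (forall e : R, 0 < e -> exists2 a, S a & supnorm (fun g => f g - a g) < e) ->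
    S f
}.

End Classes.

(** * Relational structures *)

Record language := Language { symbol : Type; arity : symbol -> nat }.

Record structure (L : language) := RelStructure {
  carrier :> Type;
  interp : forall s : symbol L, ('I_(arity s) -> carrier) -> Prop;
  carrier_inhabited : inhabited carrier
}.
Arguments interp {L} _ s x.

Section Structures.
Context {L : language}.
Implicit Types A B C F : structure L.

Record embedding A B := Embedding {
  emb_fun :> A -> B;
  emb_inj : injective emb_fun;
  emb_interp : forall s x, interp B s (emb_fun \o x) <-> interp A s x
}.

Lemma emb_eq A B (f k : embedding A B) : f =1 k -> f = k.
Proof.
case: f k => [f fi fr] [k ki kr] /= /funext fk; subst k.
by rewrite (Prop_irrelevance fi ki) (Prop_irrelevance fr kr).
Qed.

Lemma comp_inj_subproof A B C (f : embedding B C) (g : embedding A B) :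
  injective (f \o g).
Proof. exact: inj_comp (@emb_inj _ _ f) (@emb_inj _ _ g). Qed.

Lemma comp_interp_subproof A B C (f : embedding B C) (g : embedding A B) s x :
  interp C s ((f \o g) \o x) <-> interp A s x.
Proof. by rewrite -compA emb_interp emb_interp. Qed.

Definition emb_comp A B C (f : embedding B C) (g : embedding A B) :=
  Embedding (@comp_inj_subproof A B C f g) (@comp_interp_subproof A B C f g).

(* The finite substructures of [F], given by their underlying sets: in a
   relational language every non-empty subset carries a substructure. *)
Record finsub F := FinSub {
  finsub_set :> set F;
  finsub_finite : finite_set finsub_set;
  finsub_neq0 : finsub_set !=set0
}.

Lemma substr_inhabited F (A : finsub F) : inhabited (A : set F).
Proof.
by have [x Ax] := finsub_neq0 A; exists; exact: (exist _ x (mem_set Ax)).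
Qed.

Definition substr F (A : finsub F) : structure L :=
  RelStructure (fun s x => interp F s (set_val \o x)) (substr_inhabited A).

Definition incl F (A : finsub F) : embedding (substr A) F :=
  @Embedding (substr A) F (set_val : (A : set F) -> F) val_inj
    (fun s x => conj id id).


Section Image.
Variables (F : structure L) (B : finsub F) (b : embedding (substr B) F).

Lemma emb_image_finite : finite_set (range b).
Proof.
apply: finite_image.
have -> : [set: substr B] = (set_val : (B : set F) -> F) @^-1` B.
  by apply/seteqP; split => // x _; exact: set_valP.
by apply: finite_preimage (finsub_finite B) => x y _ _; exact: val_inj.
Qed.

Lemma emb_image_neq0 : range b !=set0.
Proof. by have [x] := carrier_inhabited (substr B); exists (b x), x. Qed.

(* the substructure [b(B)] of [F] *)
Definition emb_image : finsub F := FinSub emb_image_finite emb_image_neq0.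

End Image.

Record automorphism F := Automorphism {
  aut_emb :> embedding F F;
  aut_inv : F -> F;
  aut_invK : cancel aut_inv aut_emb;
  aut_funK : cancel aut_emb aut_inv
}.

Definition ultrahomogeneous F : Prop :=
  forall (A B : finsub F) (f : embedding (substr A) (substr B)),
    (forall y, exists x, f x = y) ->
    exists g : automorphism F, forall x, g (incl A x) = incl B (f x).

Definition fraisse F : Prop := countable [set: F] /\ ultrahomogeneous F.

End Structures.

(** * The topological group of automorphisms *)

Section Automorphisms.
Context {L : language} {F : structure L}.
Implicit Types g h k : automorphism F.

Lemma aut_eq g h : g =1 h -> g = h.
Proof.
case: g h => [f f' fK f'K] [k k' kK k'K] /= /emb_eq fk; subst k.
have f'k' : f' = k' by apply/funext => x; apply: (@emb_inj _ _ _ f); rewrite fK kK.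
by subst k'; rewrite (Prop_irrelevance fK kK) (Prop_irrelevance f'K k'K).
Qed.

Lemma id_interp s (x : 'I_(arity s) -> F) : interp F s (id \o x) <-> interp F s x.
Proof. by []. Qed.

Definition aut_one : automorphism F :=
  @Automorphism _ F (Embedding (@inj_id F) id_interp) id
    (fun=> erefl) (fun=> erefl).

Lemma aut_mulK g h : cancel (aut_inv h \o aut_inv g) (emb_comp g h).
Proof. by move=> x /=; rewrite !aut_invK. Qed.

Lemma aut_mulVK g h : cancel (emb_comp g h) (aut_inv h \o aut_inv g).
Proof. by move=> x /=; rewrite !aut_funK. Qed.

Definition aut_mul g h : automorphism F := Automorphism (@aut_mulK g h) (@aut_mulVK g h).

Lemma aut_inv_interp g s (x : 'I_(arity s) -> F) :
  interp F s (aut_inv g \o x) <-> interp F s x.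
Proof.
rewrite -(emb_interp g); suff -> : g \o (aut_inv g \o x) = x by [].
by apply/funext => i /=; rewrite aut_invK.
Qed.

Definition aut_inverse g : automorphism F :=
  @Automorphism _ F (Embedding (can_inj (@aut_invK _ _ g)) (aut_inv_interp g)) g
    (@aut_funK _ _ g) (@aut_invK _ _ g).

HB.instance Definition _ := gen_eqMixin (automorphism F).
HB.instance Definition _ := gen_choiceMixin (automorphism F).

Lemma aut_mulA : associative aut_mul.
Proof. by move=> g h k; exact: aut_eq. Qed.
Lemma aut_mul1 : left_id aut_one aut_mul.
Proof. by move=> g; exact: aut_eq. Qed.
Lemma aut_mulr1 : right_id aut_one aut_mul.
Proof. by move=> g; exact: aut_eq. Qed.
Lemma aut_mulV : left_inverse aut_one aut_inverse aut_mul.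
Proof. by move=> g; apply: aut_eq => x /=; rewrite aut_funK. Qed.
Lemma aut_mulrV : right_inverse aut_one aut_inverse aut_mul.
Proof. by move=> g; apply: aut_eq => x /=; rewrite aut_invK. Qed.

HB.instance Definition _ := isGroup.Build (automorphism F)
  aut_mulA aut_mul1 aut_mulr1 aut_mulV aut_mulrV.

(* [aut_open] makes the sets [g * stab A] a base of neighborhoods of [g]. *)
Definition stab (A : finsub F) : set (automorphism F) :=
  [set k | forall x, finsub_set A x -> k x = x].

Definition aut_open : set_system (automorphism F) :=
  [set O | forall g, O g -> exists A, forall k, stab A k -> O (g * k)%g].

Lemma finsubU_finite (A B : finsub F) : finite_set (A `|` B).
Proof. by rewrite finite_setU; split; exact: finsub_finite. Qed.
Lemma finsubU_neq0 (A B : finsub F) : (A `|` B) !=set0.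
Proof. by have [x Ax] := finsub_neq0 A; exists x; left. Qed.
Definition finsubU (A B : finsub F) := FinSub (finsubU_finite A B) (finsubU_neq0 A B).

Lemma translate_finite g (A : finsub F) : finite_set (g @` A).
Proof. exact/finite_image/finsub_finite. Qed.
Lemma translate_neq0 g (A : finsub F) : (g @` A) !=set0.
Proof. by have [x Ax] := finsub_neq0 A; exists (g x), x. Qed.
Definition translate g (A : finsub F) :=
  FinSub (translate_finite g A) (translate_neq0 g A).

Lemma aut_openT : aut_open setT.
Proof.
move=> g _; case: (carrier_inhabited F) => x.
have x0 : [set x] !=set0 by exists x.
by exists (FinSub (finite_set1 x) x0).
Qed.

Lemma aut_openI : setI_closed aut_open.
Proof.
move=> O O' oO oO' g [/oO[A AO] /oO'[B BO']]; exists (finsubU A B) => k kAB.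
by split; [apply: AO => x Ax; apply: kAB; left|apply: BO' => x Bx; apply: kAB; right].
Qed.

Lemma aut_open_bigU (I : Type) (f : I -> set (automorphism F)) :
  (forall i, aut_open (f i)) -> aut_open (\bigcup_i f i).
Proof. by move=> fo g [i _ /fo[A Af]]; exists A => k /Af; exists i. Qed.

HB.instance Definition _ := isOpenTopological.Build (automorphism F)
  aut_openT aut_openI aut_open_bigU.

Lemma aut_mulE g h x : (g * h)%g x = g (h x). Proof. by []. Qed.

Lemma stab_aut_open g (A : finsub F) : aut_open [set h | stab A (g^-1 * h)%g].
Proof.
move=> h Ah; exists A => k Ak.
suff : stab A (g^-1 * (h * k))%g by [].
by rewrite mulgA => x Ax; rewrite aut_mulE (Ak x Ax) Ah.
Qed.

Lemma nbhs_autP g (U : set (automorphism F)) : nbhs g U <->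
  exists A : finsub F, forall k, stab A k -> U (g * k)%g.
Proof.
rewrite nbhsE; split=> [[V [oV Vg] VU]|[A AU]].
  by have [A AV] := oV g Vg; exists A => k /AV/VU.
exists [set h | stab A (g^-1 * h)%g].
  by split; [exact: stab_aut_open|by rewrite /= mulVg].
by move=> h /AU; rewrite mulgA mulgV mul1g.
Qed.

Lemma aut_mul_continuous :
  continuous (fun p : automorphism F * automorphism F => (p.1 * p.2)%g).
Proof.
move=> [g h] W /nbhs_autP[A AW].
exists ([set g' | stab (translate h A) (g^-1 * g')%g], [set h' | stab A (h^-1 * h')%g]) => /=.
  split; apply/nbhs_autP.
    by exists (translate h A) => k; rewrite /= mulgA mulVg mul1g.
  by exists A => k; rewrite /= mulgA mulVg mul1g.
move=> [g' h'] [/= gg' hh'].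
suff : stab A ((g * h)^-1 * (g' * h'))%g by move=> /AW; rewrite mulgA mulgV mul1g.
move=> x Ax; have hx : h' x = h x.
  by rewrite -[in RHS](hh' x Ax) -aut_mulE mulgA mulgV mul1g.
rewrite invgM -mulgA mulgA -mulgA !aut_mulE hx -(aut_mulE _ g') gg'; last by exists x.
by rewrite -aut_mulE mulVg.
Qed.

Lemma aut_inv_continuous : continuous (fun g : automorphism F => (g^-1)%g).
Proof.
move=> g W /nbhs_autP[A AW]; apply/nbhs_autP; exists (translate g^-1%g A) => k kA.
suff : stab A (g * (g * k)^-1)%g by move=> /AW; rewrite mulgA mulVg mul1g.
move=> x Ax; rewrite invgM mulgA !aut_mulE.
have {1}<- : k (g^-1%g x) = g^-1%g x by apply: kA; exists x.
by rewrite -(aut_mulE (k^-1)%g k) mulVg -(aut_mulE g 1%g) mulg1 -aut_mulE mulgV.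
Qed.

HB.instance Definition _ := isTopologicalGroup.Build (automorphism F)
  aut_mul_continuous aut_inv_continuous.

Lemma nbhs1_stabP (U : set (automorphism F)) :
  nbhs 1%g U <-> exists A, stab A `<=` U.
Proof.
by split => [/nbhs_autP|] [A AU]; [exists A => k /AU|apply/nbhs_autP; exists A => k /AU];
  rewrite mul1g.
Qed.

End Automorphisms.

(** * Colorings and the Ramsey property *)

Section Colorings.
Context {R : realType} {L : language} {F : structure L}.
Implicit Types (A B : finsub F) (S : set (automorphism F -> R[i])).

Definition coloring A := embedding (substr A) F -> R[i].

Definition finite_coloring A (c : coloring A) : Prop := finite_set (range c).

(* A coloring is identified with a function on the automorphism group by
   restricting inverses of automorphisms to [A]. *)
Definition coloring_fun A (c : coloring A) : automorphism F -> R[i] :=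
  fun g => c (emb_comp (g^-1)%g (incl A)).

(* Embeddings of [A] into a substructure [C] of [F] are turned into embeddings
   into [F] by composing with the inclusion of [C]. *)
Definition constant_on A (c : coloring A) (C : finsub F) : Prop :=
  forall a a' : embedding (substr A) (substr C),
    c (emb_comp (incl C) a) = c (emb_comp (incl C) a').

Definition constant_upto_on (e : R) A (c : coloring A) (C : finsub F) : Prop :=
  forall a a' : embedding (substr A) (substr C),
    normc (c (emb_comp (incl C) a) - c (emb_comp (incl C) a')) < e.

Definition ramsey S : Prop :=
  forall A B (C : set (coloring A)), finite_set C ->
    (forall c, C c -> finite_coloring c /\ S (coloring_fun c)) ->
    exists b : embedding (substr B) F,
      forall c, C c -> constant_on c (emb_image b).

Definition ramsey_upto (e : R) S : Prop :=
  forall A B (C : set (coloring A)), finite_set C ->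
    (forall c, C c -> finite_coloring c /\ S (coloring_fun c)) ->
    exists b : embedding (substr B) F,
      forall c, C c -> constant_upto_on e c (emb_image b).

Definition finite_colorings_dense S : Prop :=
  forall f, S f -> forall e : R, 0 < e ->
    exists A (c : coloring A),
      [/\ finite_coloring c, S (coloring_fun c) &
          supnorm (fun g => f g - coloring_fun c g) < e].

End Colorings.

(* Main.v *)
From mathcomp Require Import all_boot all_order all_algebra.
From mathcomp Require Import complex.
From mathcomp Require Import all_classical all_reals all_analysis.
From mathcomp Require Import finmap ring lra.
Require Import Defs.

(** Let [A] be the set of functions [f] whose flow of right translates is in the
    class.

    Why [A] is an algebra. The supremum [Z] of the flows of right translates of
    all members of [A] is an ambit of the class, with distinguished point [z0].
    A function [f] is in [A] if and only if [f g = phi (g z0)] for some continuous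
    [phi] on [Z] ([flow_algebraP]): a member of [A] is a coordinate of [Z], and
    conversely the flow of right translates of [g |-> phi (g z0)] is a factor of
    [Z], by the map that sends [z] to the function [h |-> phi (h z)]
    ([shift_ambit_factor]). So [A] is a copy of the algebra of continuous functions
    on the compact space [Z]. It is closed because a uniform limit along the dense
    orbit extends to [Z] ([extend_uniform_limit]).

    From fixed points to Ramsey. Copies of a finite [A0] are restrictions of
    inverses of automorphisms, and the copies of [A0] inside [g^-1 B] are the
    [(h g)^-1 A0] for finitely many [h] that depend only on [A0] and [B]
    ([copies_in_translates]). If [Z] has a fixed point [p], choose [g] with [g z0]
    so close to [p] that all the [h g z0] are close to [h p = p]: the continuous
    functions on [Z] take at these points almost the same value, so that colorings
    close to [A] are almost constant on the copies ([copy_near_fixed_point]). For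
    finite colorings in [A] itself, the supremum of their own flows of translates
    is zero-dimensional, these colorings are locally constant on it, and the same
    argument gives exact constancy.

    From Ramsey to fixed points. A right-uniformly continuous function is almost
    constant on the right cosets of the stabilizer of some finite [A0], so it is
    uniformly close to a finite coloring of the copies of [A0]
    ([finite_coloring_approx]). Applied to the functions [g |-> phi (g y)], with
    [phi] continuous on an ambit [(Y, y)] of the class, the Ramsey property then
    gives points [g y] at which finitely many [phi] are almost unchanged by finitely
    many group elements; compactness turns them into a fixed point
    ([fixed_point_of_ramsey]). In general the approximating colorings are only
    close to [A], whence the approximate Ramsey property; they can be taken in [A]
    when the finite colorings are dense in [A], and also when [phi] is the
    indicator of a clopen set, because its function on the group is a finite
    coloring. Such indicators separate the points of a zero-dimensional flow. *)

Set Implicit Arguments.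
Unset Strict Implicit.
Unset Printing Implicit Defensive.

Import Order.TTheory GRing.Theory Num.Theory.
Import numFieldNormedType.Exports.
Import ComplexField.Normc.

Local Open Scope classical_set_scope.
Local Open Scope ring_scope.

(** * Ambits of right translates *)

Lemma set_type_cvg (T : topologicalType) (K : set T) (F : set_system K) (x : K) :
  Filter F -> set_val @ F --> set_val x -> F --> x.
Proof.
by move=> FF Fx W /nbhs_set_type[V Vx VW]; apply: filterS VW _; exact: Fx.
Qed.

Section ShiftAmbits.
Context {R : realType} {G : topGroupType}.
Implicit Types (f : G -> R[i]) (S : set (G -> R[i])).

Section ShiftAmbit.
Variables (f : G -> R[i]) (hf : RUCb f).

Definition shift_pt : right_shift_flow hf :=
  exist _ f (mem_set (subset_closure (rorbit_self f))).

Lemma shift_pt_dense : closure (flow_orbit shift_pt) = [set: right_shift_flow hf].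
Proof.
apply/seteqP; split => // y _ W /nbhs_set_type[V Vy VW].
have [_ [[g _ <-] Vz]] := set_mem (valP y) V Vy.
by exists (flow_act g shift_pt); split; [exists g|apply: VW].
Qed.

Definition shift_ambit : ambit := Ambit shift_pt_dense.

End ShiftAmbit.

Section JointShiftAmbit.
Variables (S : set (G -> R[i])) (hS : S `<=` RUCb).

(** The supremum of the flows of right translates of the members of [S]. When
    [S] is the algebra attached to a class of flows closed under suprema and
    factors, the continuous functions on it are exactly that algebra. *)
Definition joint_ambit : ambit :=
  sup_ambit (fun i : {f | S f} => shift_ambit (hS (proj2_sig i))).

Definition joint_eval f (Sf : S f) (h : G) (z : joint_ambit) : R[i] :=
  set_val (set_val z (exist _ f Sf)) h.

Lemma joint_eval_continuous f (Sf : S f) h : continuous (joint_eval Sf h).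
Proof.
move=> z W Wz.
have H1 := @prod_proj_continuous G (fun=> R[i]) h
  (set_val (set_val z (exist _ f Sf))) W Wz.
have H2 := @set_type_continuous _ _ (set_val z (exist _ f Sf)) _ H1.
have H3 := @prod_proj_continuous _ (fun i : {f | S f} => shift_ambit (hS (proj2_sig i)))
  (exist _ f Sf) (set_val z) _ H2.
exact: (@set_type_continuous _ _ z _ H3).
Qed.

Lemma joint_eval_act f (Sf : S f) h g z :
  joint_eval Sf h (flow_act g z) = joint_eval Sf (h * g)%g z.
Proof. by []. Qed.

Lemma joint_eval_pt f (Sf : S f) h : joint_eval Sf h (ambit_pt joint_ambit) = f h.
Proof. by []. Qed.

(** The coordinates [joint_eval] generate the topology: the ambit is a subspace
    of a product of subspaces of spaces of functions with pointwise convergence.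
    *)
Lemma joint_cvg (F : set_system joint_ambit) (z : joint_ambit) : Filter F ->
  (forall f (Sf : S f) h W, nbhs (joint_eval Sf h z) W ->
     F (joint_eval Sf h @^-1` W)) -> F --> z.
Proof.
move=> FF Fz; apply: (@set_type_cvg _ _ F z FF).
pose Y := fun i : {f | S f} => shift_ambit (hS (proj2_sig i)).
apply: (@prod_cvg _ Y (set_val @ F) (set_val z) (fmap_filter _ FF)) => -[f Sf].
pose k := fun y : joint_ambit => set_val y (exist _ f Sf).
apply: (@set_type_cvg _ _ (k @ F) (k z) (fmap_filter _ FF)) => W Wz.
have FF' := fmap_filter (fun y => set_val (k y) : {ptws G -> R[i]}) FF.
by apply: (ptws_cvg FF' _ Wz) => h U; exact: Fz.
Qed.

Lemma joint_ambit_in (X : flow G -> Prop) : closed_under_suprema X ->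
  S `<=` flow_algebra X -> X joint_ambit.
Proof.
move=> X_sup SX; apply: X_sup => -[f Sf] /=.
by have [hf Xf] := SX f Sf; rewrite (Prop_irrelevance (hS _) hf).
Qed.

End JointShiftAmbit.
End ShiftAmbits.

(** * Continuous functions on an ambit *)

Section AmbitFunctions.
Context {R : realType} {G : topGroupType}.
Implicit Types (f : G -> R[i]) (X : flow G -> Prop).

Lemma near_normc (T : topologicalType) (phi : T -> R[i]) (x : T) (e : R) :
  {for x, continuous phi} -> 0 < e -> \forall y \near x, normc (phi x - phi y) < e.
Proof.
move=> c e0; apply: (c [set z | normc (phi x - z) < e]).
by apply/nbhs_normcP; exists e.
Qed.

Lemma normc_continuous_at (T : topologicalType) (phi : T -> R[i]) (x : T) :
  (forall e : R, 0 < e -> \forall y \near x, normc (phi x - phi y) < e) ->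
  {for x, continuous phi}.
Proof.
move=> H W /nbhs_normcP[e e0 eW].
exact: (filterS (fun y h => eW (phi y) h) (H e e0)).
Qed.

Lemma flow_function_bounded (Y : flow G) (phi : Y -> R[i]) : continuous phi ->
  exists M : R, forall y, normc (phi y) <= M.
Proof.
move=> cphi.
have /compact_near_coveringP cov := @flow_compact _ Y.
have [y _|M [_ HM]] := cov R +oo (fun M y => normc (phi y) <= M) _.
  exists ([set y' | normc (phi y - phi y') < 1], [set M | normc (phi y) + 1 < M]) => /=.
    by split; [exact: near_normc (cphi y) ltr01|exact: nbhs_pinfty_gt (num_real _)].
  move=> [y' M] [/= yy' HM]; apply: ltW; apply: le_lt_trans HM.
  rewrite -[phi y']subr0 (le_trans (normc_triangle _ (phi y) _)) // subr0 addrC.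
  by rewrite lerD2l normcB_sym ltW.
exists (M + 1) => y; apply: (HM (M + 1)) => //.
by rewrite ltrDl.
Qed.

(** By compactness the neighborhood of the identity given by the joint
    continuity of the action can be taken independent of the point. This
    uniformity becomes right uniform continuity along an orbit. *)
Lemma flow_function_equicontinuous (Y : flow G) (phi : Y -> R[i]) (e : R) :
  continuous phi -> 0 < e ->
  \forall u \near (1%g : G), forall y, normc (phi (flow_act u y) - phi y) < e.
Proof.
move=> cphi e0.
have /compact_near_coveringP cov := @flow_compact _ Y.
pose P u y := normc (phi (flow_act u y) - phi y) < e.
suff H y : [set: Y] y -> \forall y' \near y & u \near (1%g : G), P u y'.
  by apply: filterS (cov G _ P (nbhs_filter _) H) => u Hu y; exact: Hu.
move=> _; have e20 : 0 < e / 2 by rewrite divr_gt0.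
have cy := near_normc (cphi y) e20.
have := @flow_act_continuous _ Y (1%g, y) [set y' | normc (phi y - phi y') < e / 2].
rewrite /= flow_act1 => /(_ cy) [[U V] /= [U1 Vy] UV].
exists (V `&` [set y' | normc (phi y - phi y') < e / 2], U) => /=.
  by split => //; exact: filterI.
move=> [y' u] [/= [Vy' yy'] Uu].
have /= Huy := UV (u, y') (conj Uu Vy').
apply: le_lt_trans (normc_triangle _ (phi y) _) _.
by rewrite (splitr e) ltrD // normcB_sym.
Qed.

(** As the orbit of the distinguished point is dense, [phi] is determined by
    [ambit_function phi]. *)
Definition ambit_function (Y : ambit (G := G)) (phi : Y -> R[i]) : G -> R[i] :=
  fun g => phi (flow_act g (ambit_pt Y)).

Lemma ambit_function_RUCb (Y : ambit) (phi : Y -> R[i]) :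
  continuous phi -> RUCb (ambit_function phi).
Proof.
move=> cphi; split.
  by have [M HM] := flow_function_bounded cphi; exists M => g; exact: HM.
move=> e e0; exists [set u | forall y, normc (phi (flow_act u y) - phi y) < e].
  exact: flow_function_equicontinuous.
by move=> g h /(_ (flow_act h (ambit_pt Y))); rewrite -flow_actM mulgVK.
Qed.

Section ShiftFactor.
Variables (Y : ambit (G := G)) (phi : Y -> R[i]) (cphi : continuous phi).

Let code (y : Y) : {ptws G -> R[i]} := fun h => phi (flow_act h y).

Let code_continuous : continuous code.
Proof.
move=> y; apply: ptws_continuous => h.
apply: (@continuous_comp _ _ _ (flow_act h) phi); first exact: act_cont_r.
exact: cphi.
Qed.

Let code_closure y : closure (rorbit (ambit_function phi)) (code y).
Proof.
move=> W Wy; have : closure (flow_orbit (ambit_pt Y)) y by rewrite ambit_dense.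
move=> /(_ _ (code_continuous Wy))[_ [[g _ <-] Wg]].
exists (code (flow_act g (ambit_pt Y))); split => //; exists g => //.
by apply/funext => h; rewrite /right_shift /ambit_function /code flow_actM.
Qed.

(** The factor map sends [y] to its itinerary [h |-> phi (h y)]. Moving [y] by
    [g] right shifts the itinerary by [g], and the itinerary of the
    distinguished point is the function whose translates are considered. *)
Lemma shift_ambit_factor : is_factor (shift_ambit (ambit_function_RUCb cphi)) Y.
Proof.
exists (fun y => exist _ (code y) (mem_set (@code_closure y))); split.
- move=> y; pose F := (fun y : Y => exist _ (code y) (mem_set (@code_closure y))
    : closure (rorbit (ambit_function phi))) @ y.
  by apply: (@set_type_cvg _ _ F); exact: code_continuous.
- by move=> g y; apply/val_inj/funext => h /=; rewrite /right_shift /code flow_actM.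
- exact/val_inj.
Qed.

Lemma ambit_function_in_algebra X : closed_under_factors X -> X Y ->
  flow_algebra X (ambit_function phi).
Proof.
move=> X_factor XY; exists (ambit_function_RUCb cphi).
exact: (X_factor _ _ XY shift_ambit_factor).
Qed.

End ShiftFactor.
End AmbitFunctions.

(** * The algebra attached to a class of flows *)

Section Supnorm.
Context {R : realType} {G : topGroupType}.
Implicit Types (f a : G -> R[i]).

(** Both functions have to be bounded: the supremum of an unbounded set of reals
    is a default value. *)
Lemma supnorm_ge f a : RUCb f -> RUCb a ->
  forall g, normc (f g - a g) <= supnorm (fun g => f g - a g).
Proof.
move=> [[M fM] _] [[N aN] _] g; apply: ub_le_sup; last by exists g.
exists (M + N) => _ [h _ <-].
by rewrite (le_trans (le_normcD _ _)) // normcN lerD.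
Qed.

Lemma supnorm_le f (e : R) : (forall g, normc (f g) <= e) -> supnorm f <= e.
Proof.
move=> fe; apply: ge_sup; first by exists (normc (f 1%g)), 1%g.
by move=> _ [g _ <-].
Qed.

Lemma normc_ge0 (z : R[i]) : 0 <= normc z.
Proof. by case: z => a b; exact: sqrtr_ge0. Qed.

Lemma normc_square (M : R) (z : R[i]) : normc z <= M ->
  `|complex.Re z| <= M /\ `|complex.Im z| <= M.
Proof.
case: z => x y /= xyM; split; apply: le_trans xyM;
  by rewrite -sqrtr_sqr ler_sqrt ?addr_ge0 ?sqr_ge0 // ?lerDl ?lerDr sqr_ge0.
Qed.

Lemma eq_of_normc_small (z w : R[i]) (c : R) :
  0 <= c -> (forall e : R, 0 < e -> normc (z - w) <= c * e) -> z = w.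
Proof.
move=> c0 H; apply/eqP; rewrite -subr_eq0; apply/eqP/eq0_normc/eqP.
rewrite eq_le normc_ge0 andbT; apply/ler_addgt0Pr => e e0; rewrite add0r.
have c1 : 0 < c + 1 by rewrite ltr_wpDl.
apply: (le_trans (H (e / (c + 1)) _)); first by rewrite divr_gt0.
by rewrite mulrA ler_pdivrMr // mulrC ler_pM2l // lerDl.
Qed.

(** A uniform limit, along a dense orbit, of continuous functions of the ambit
    is again given by a continuous function of the ambit. Its value at [z] is a
    cluster point of [f g] as [g] sends the distinguished point towards [z].
    Such a cluster point exists because [f] is bounded, and it is within a fixed
    multiple of [e] of the value at [z] of every [e]-approximation of [f]; this
    gives both continuity and the agreement with [f]. *)
Lemma extend_uniform_limit (Y : ambit (G := G)) f (M : R) :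
  (forall g, normc (f g) <= M) ->
  (forall e : R, 0 < e -> exists2 phi : Y -> R[i], continuous phi &
     forall g, normc (f g - ambit_function phi g) <= e) ->
  exists2 phi : Y -> R[i], continuous phi & f = ambit_function phi.
Proof.
move=> fM approx; pose o g : Y := flow_act g (ambit_pt Y).
(* [w] is a cluster point of [f] along the neighborhoods of [z]. *)
have /choice[psi psiP] z : exists w : R[i], forall (e : R) (phi : Y -> R[i]),
    continuous phi -> 0 < e -> (forall g, normc (f g - phi (o g)) <= e) ->
    normc (w - phi z) <= 2 * e.
  pose F : set_system G := [set A | exists2 V, nbhs z V & o @^-1` V `<=` A].
  have FF : ProperFilter F.
    split.
      move=> [V Vz oV]; have : closure (flow_orbit (ambit_pt Y)) z by rewrite ambit_dense.
      by move=> /(_ _ Vz)[_ [[g _ <-] Vg]]; exact: (oV g).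
    split; first by exists setT => //; exact: filterT.
      move=> A B [V Vz VA] [W Wz WB]; exists (V `&` W); first exact: filterI.
      by move=> g [/VA Ag /WB Bg].
    by move=> A B AB [V Vz VA]; exists V => // g /VA/AB.
  have [|w [_ cw]] := @square_compact R M (f @ F) (fmap_proper_filter f FF).
    exists setT; first exact: filterT.
    by move=> g _; exact: normc_square (fM g).
  exists w => e phi cphi e0 fphi; have e20 : 0 < e / 2 by rewrite divr_gt0.
  have Fe : (f @ F) (f @` [set g | normc (phi z - phi (o g)) < e / 2]).
    exists [set y | normc (phi z - phi y) < e / 2]; first exact: near_normc (cphi z) e20.
    by move=> g /= ge; exists g.
  have we : nbhs w [set v | normc (w - v) < e / 2] by apply/nbhs_normcP; exists (e / 2).
  have [_ [[g /= zg <-] wg]] := cw _ _ Fe we.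
  apply: (le_trans (normc_triangle _ (f g) _)).
  have -> : 2 * e = e / 2 + (e + e / 2) by field.
  rewrite lerD ?(ltW wg) // (le_trans (normc_triangle _ (phi (o g)) _)) //.
  by rewrite lerD // normcB_sym ltW.
exists psi.
  move=> z; apply: normc_continuous_at => e e0.
  have d0 : 0 < e / 5 by rewrite divr_gt0.
  have [phi cphi fphi] := approx _ d0.
  near=> y.
  have zy : normc (phi z - phi y) < e / 5.
    by near: y; exact: near_normc (cphi z) d0.
  apply: (le_lt_trans (normc_triangle _ (phi z) _)).
  have -> : e = 2 * (e / 5) + (e / 5 + 2 * (e / 5)) by field.
  apply: ler_ltD; first exact: psiP.
  apply: (le_lt_trans (normc_triangle _ (phi y) _)).
  by apply: ltr_leD => //; rewrite normcB_sym; exact: psiP.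
apply/funext => g; apply: (@eq_of_normc_small _ _ 3) => // e e0.
have [phi cphi fphi] := approx _ e0.
apply: (le_trans (normc_triangle _ (phi (o g)) _)).
have -> : 3 * e = e + 2 * e by ring.
by rewrite lerD ?fphi // normcB_sym; exact: psiP.
Unshelve. all: by end_near. Qed.

End Supnorm.

Section ContinuousOps.
Context {R : realType} {G : topGroupType}.
Variables (Y : flow G) (phi psi : Y -> R[i]).
Hypotheses (cphi : continuous phi) (cpsi : continuous psi).

Lemma flow_functionD_continuous : continuous (fun z => phi z + psi z).
Proof.
move=> z; apply: normc_continuous_at => e e0.
have e20 : 0 < e / 2 by rewrite divr_gt0.
near=> y.
have ph : normc (phi z - phi y) < e / 2 by near: y; exact: near_normc (@cphi z) e20.
have ps : normc (psi z - psi y) < e / 2 by near: y; exact: near_normc (@cpsi z) e20.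
rewrite opprD addrACA (splitr e).
by apply: (le_lt_trans (le_normcD _ _)); rewrite ltrD.
Unshelve. all: by end_near. Qed.

Lemma flow_functionM_continuous : continuous (fun z => phi z * psi z).
Proof.
move=> z; apply: normc_continuous_at => e e0.
have [M phiM] := flow_function_bounded cphi.
have [N psiN] := flow_function_bounded cpsi.
pose B := `|M| + `|N| + 1; have B0 : 0 < B by rewrite ltr_wpDl // addr_ge0.
have phiB y : normc (phi y) <= B.
  by rewrite (le_trans (phiM y)) // (le_trans (ler_norm M)) // /B -addrA lerDl addr_ge0.
have psiB y : normc (psi y) <= B.
  rewrite (le_trans (psiN y)) // (le_trans (ler_norm N)) // /B addrAC lerDr.
  by rewrite addr_ge0.
have d0 : 0 < e / (2 * B) by rewrite divr_gt0 // mulr_gt0.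
near=> y.
have ph : normc (phi z - phi y) < e / (2 * B) by near: y; exact: near_normc (@cphi z) d0.
have ps : normc (psi z - psi y) < e / (2 * B) by near: y; exact: near_normc (@cpsi z) d0.
have -> : phi z * psi z - phi y * psi y =
  (phi z - phi y) * psi z + phi y * (psi z - psi y) by ring.
apply: (le_lt_trans (le_normcD _ _)); rewrite !normcM.
have -> : e = e / (2 * B) * B + B * (e / (2 * B)) by field; rewrite gt_eqF.
apply: ler_ltD.
  by rewrite ler_pM ?normc_ge0 // ltW.
apply: (@le_lt_trans _ _ (B * normc (psi z - psi y))).
  by rewrite ler_pM ?normc_ge0.
by rewrite ltr_pM2l.
Unshelve. all: by end_near. Qed.

End ContinuousOps.

Section FlowAlgebra.
Context {R : realType} {G : topGroupType}.
Variable X : flow G -> Prop.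
Hypotheses (X_sup : closed_under_suprema X) (X_factor : closed_under_factors X).
Let A : set (G -> R[i]) := flow_algebra X.

Lemma flow_algebra_RUCb : A `<=` RUCb.
Proof. by move=> f [hf _]. Qed.

(** Every member of the algebra is read off one ambit of the class. *)
Definition greatest_ambit : ambit := joint_ambit flow_algebra_RUCb.

Lemma greatest_ambit_in : X greatest_ambit.
Proof. exact: (joint_ambit_in _ X_sup). Qed.

(** The algebra is the algebra of continuous functions on [greatest_ambit], seen
    along the orbit of its distinguished point. From left to right, [f] is the
    evaluation at the identity of its own coordinate; conversely a continuous
    function of an ambit yields a factor of it. *)
Lemma flow_algebraP f : A f <->
  exists2 phi : greatest_ambit -> R[i], continuous phi & f = ambit_function phi.
Proof.
split=> [Af|[phi cphi ->]]; last exact: ambit_function_in_algebra greatest_ambit_in.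
exists (joint_eval Af 1%g); first exact: joint_eval_continuous.
by apply/funext => g; rewrite /ambit_function joint_eval_act mul1g.
Qed.

(** All closure properties are those of the continuous functions on the compact
    space [greatest_ambit]; the left shift by [k] is the composition with the
    action of [k^-1]. *)
Lemma flow_algebra_subCstar : unital_left_invariant_closed_subCstar A.
Proof.
split.
- exact: flow_algebra_RUCb.
- by apply/flow_algebraP; exists (fun=> 1) => // z; exact: cst_continuous.
- move=> _ _ /flow_algebraP[phi cphi ->] /flow_algebraP[psi cpsi ->].
  apply/flow_algebraP; exists (fun z => phi z + psi z); last by [].
  exact: (@flow_functionD_continuous R G greatest_ambit phi psi cphi cpsi).
- move=> c _ /flow_algebraP[phi cphi ->].
  apply/flow_algebraP; exists (fun z => c * phi z); last by [].
  have cc : continuous (fun _ : greatest_ambit => c) by move=> z; exact: cst_continuous.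
  exact: (@flow_functionM_continuous R G greatest_ambit (fun=> c) phi cc cphi).
- move=> _ _ /flow_algebraP[phi cphi ->] /flow_algebraP[psi cpsi ->].
  apply/flow_algebraP; exists (fun z => phi z * psi z); last by [].
  exact: (@flow_functionM_continuous R G greatest_ambit phi psi cphi cpsi).
- move=> _ /flow_algebraP[phi cphi ->].
  apply/flow_algebraP; exists (fun z => conjc (phi z)); last by [].
  move=> z; apply: normc_continuous_at => e e0; apply: filterS (near_normc (cphi z) e0) => y.
  by case: (phi z) (phi y) => [a b] [c d] /=; rewrite -opprD sqrrN.
- move=> k _ /flow_algebraP[phi cphi ->].
  apply/flow_algebraP; exists (fun z => phi (flow_act k^-1%g z)).
    move=> z; apply: (@continuous_comp _ _ _ (flow_act k^-1%g) phi); first exact: act_cont_r.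
    exact: cphi.
  by apply/funext => h; rewrite /left_shift /ambit_function flow_actM.
- move=> f hf approx; apply/flow_algebraP; have [[M fM] _] := hf.
  apply: (extend_uniform_limit fM) => e e0.
  have [a Aa fa] := approx e e0; have [phi cphi aphi] := (flow_algebraP a).1 Aa.
  exists phi => // g; rewrite -aphi.
  exact: le_trans (supnorm_ge hf (flow_algebra_RUCb Aa) g) (ltW fa).
Qed.

End FlowAlgebra.

(** * Copies of finite substructures and automorphisms *)

Section Embeddings.
Context {L : language} {F : structure L}.
Implicit Types (A B : finsub F) (g h : automorphism F).

Section Corestrict.
Variables (A B : finsub F) (a : embedding (substr A) F).
Hypothesis aB : forall x, finsub_set B (a x).

Let cofun (x : substr A) : substr B := exist _ (a x) (mem_set (aB x)).

Let cofun_inj : injective cofun.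
Proof. by move=> x y /(congr1 val) /= /(@emb_inj _ _ _ a). Qed.

Let cofun_interp s x : interp (substr B) s (cofun \o x) <-> interp (substr A) s x.
Proof. exact: (emb_interp a x). Qed.

Definition corestrict : embedding (substr A) (substr B) :=
  Embedding cofun_inj cofun_interp.

Lemma corestrictE : emb_comp (incl B) corestrict = a.
Proof. exact: emb_eq. Qed.

End Corestrict.

Lemma emb_congr1 (A : finsub F) (B : structure L) (f f' : embedding (substr A) B) :
  f = f' -> forall x, f x = f' x.
Proof. by move=> ->. Qed.

(** This is why a function on the group comes from a coloring of the copies of
    [A] as soon as it is constant on the right cosets of the stabilizer of [A].
    *)
Lemma restrictVP A g h : emb_comp g^-1%g (incl A) = emb_comp h^-1%g (incl A) <->
  stab A (g * h^-1)%g.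
Proof.
split=> [/emb_congr1 gh x Ax|gh].
  have e : g^-1%g x = h^-1%g x := gh (exist _ x (mem_set Ax)).
  by rewrite aut_mulE -e -aut_mulE mulgV.
apply: emb_eq => x; have e := gh (val x) (set_mem (valP x)).
suff : g^-1%g (val x) = h^-1%g (val x) by [].
by rewrite -[in LHS]e -aut_mulE mulgA mulVg mul1g.
Qed.

Lemma finite_fun_set (T U : Type) :
  finite_set [set: T] -> finite_set [set: U] -> finite_set [set: T -> U].
Proof.
elim/Pchoice: T => T; elim/Pchoice: U => U.
move=> /finite_seqP[s sT] /finite_seqP[t tT].
(* Functions inject into tuples of positions in an enumeration of [U]. *)
pose code (f : T -> U) : (size s).-tuple 'I_(size t).+1 :=
  [tuple inord (index (f (tnth (in_tuple s) i)) t) | i < size s].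
have code_inj : {in code @^-1` setT &, injective code}.
  move=> f f' _ _ ff'; apply/funext => x.
  have xs : x \in s by have : [set` s] x by rewrite -sT.
  have mt y : y \in t by have : [set` t] y by rewrite -tT.
  have xi : (index x s < size s)%N by rewrite index_mem.
  have := congr1 (fun u => nat_of_ord (tnth u (Ordinal xi))) ff'.
  rewrite !tnth_mktuple !inordK ?ltnS ?index_size // !(tnth_nth x) /= nth_index //.
  by move=> /(congr1 (nth (f x) t)); rewrite !nth_index.
have -> : [set: T -> U] = code @^-1` setT by [].
by apply: finite_preimage => //; exact: finite_finset.
Qed.

Lemma substr_finite A : finite_set [set: substr A].
Proof.
have -> : [set: substr A] = (set_val : (A : set F) -> F) @^-1` A.
  by apply/seteqP; split => // x _; exact: set_valP.
by apply: finite_preimage (finsub_finite A) => x y _ _; exact: val_inj.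
Qed.

Lemma embeddings_finite A B : finite_set [set: embedding (substr A) (substr B)].
Proof.
have fin := finite_fun_set (substr_finite A) (substr_finite B).
have inj : {in (@emb_fun _ _ _) @^-1` [set: substr A -> substr B] &,
    injective (@emb_fun _ (substr A) (substr B))}.
  by move=> f f' _ _ ff'; apply: emb_eq => x; rewrite ff'.
exact: finite_preimage inj fin.
Qed.

Lemma emb_image_in B (b : embedding (substr B) F) x : finsub_set (emb_image b) (b x).
Proof. by exists x. Qed.

Hypothesis uh : ultrahomogeneous F.

(** By ultrahomogeneity, the copies of [A] are the restrictions to [A] of the
    inverses of automorphisms, so a coloring of the copies of [A] loses nothing
    when it is viewed as a function on the group. *)
Lemma emb_extends A (a : embedding (substr A) F) :
  exists g : automorphism F, emb_comp g^-1%g (incl A) = a.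
Proof.
have [y|g gP] := uh (f := corestrict (emb_image_in a)).
  have [x _ xy] := set_mem (valP y).
  by exists x; apply: val_inj.
by exists g^-1%g; apply: emb_eq => x; rewrite invgK; exact: gP.
Qed.

(** The finitely many embeddings of [A] into [B] extend to finitely many
    inverses of automorphisms [h]; the copies of [A] inside the copy [g^-1 B]
    are then among the [(h g)^-1 A]. So the colors of the copies of [A] in this
    copy of [B] are values of the coloring at finitely many translates [h g] of
    [g]. *)
Lemma copies_in_translates A B : exists2 H : set (automorphism F), finite_set H &
  forall g (a : embedding (substr A)
                  (substr (emb_image (emb_comp g^-1%g (incl B))))),
  exists2 h, H h & emb_comp (incl _) a = emb_comp (h * g)^-1%g (incl A).
Proof.
have /choice[h hP] e : exists h : automorphism F,
  emb_comp h^-1%g (incl A) = emb_comp (incl B) e by exact: emb_extends.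
exists (range h); first exact/finite_image/embeddings_finite.
move=> g a.
have ga x : finsub_set B ((emb_comp g (emb_comp (incl _) a)) x).
  have [y _ gy] := set_mem (valP (a x)).
  have {}gy : g^-1%g (val y) = val (a x) := gy.
  suff : finsub_set B (g (val (a x))) by [].
  by rewrite -gy -aut_mulE mulgV; exact: set_mem (valP y).
exists (h (corestrict ga)); first by exists (corestrict ga).
apply: emb_eq => x; rewrite invgM.
have e : (h (corestrict ga))^-1%g (val x) = g (val (a x)) :=
  emb_congr1 (hP (corestrict ga)) x.
suff : val (a x) = (g^-1 * (h (corestrict ga))^-1)%g (val x) by [].
by rewrite aut_mulE e -aut_mulE mulVg.
Qed.

(** Conversely, a Ramsey statement controls the values at the translates [h g]
    for any prescribed finite set of [h]: it suffices to take for [B] a finite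
    set that contains all the [h^-1 A]. *)
Lemma translates_in_copy A (H : set (automorphism F)) : finite_set H ->
  exists B, forall b : embedding (substr B) F, exists g, forall h, H h ->
    exists a : embedding (substr A) (substr (emb_image b)),
      emb_comp (incl _) a = emb_comp (h * g)^-1%g (incl A).
Proof.
move=> Hfin; pose B0 := (A : set F) `|` \bigcup_(h in H) translate h^-1%g A.
have B0fin : finite_set B0.
  rewrite finite_setU; split; first exact: finsub_finite.
  by apply: bigcup_finite => // h _; exact: finsub_finite.
have B00 : B0 !=set0 by have [x Ax] := finsub_neq0 A; exists x; left.
exists (FinSub B0fin B00) => b; have [g gb] := emb_extends b.
exists g => h Hh.
have ax x : finsub_set (emb_image b) (emb_comp (h * g)^-1%g (incl A) x).
  have Bx : B0 (h^-1%g (incl A x)).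
    by right; exists h => //; exists (incl A x) => //; exact: set_mem (valP x).
  pose y : substr (FinSub B0fin B00) := exist _ (h^-1%g (incl A x)) (mem_set Bx).
  by exists y => //; rewrite -(emb_congr1 gb) invgM.
by exists (corestrict ax); exact: corestrictE.
Qed.

End Embeddings.

(** * Finite colorings as functions on the group *)

Section Rounding.
Context {R : realType}.

(** The finite set of values is an [e]-net of a square, from its compactness. *)
Lemma finite_rounding (M e : R) : 0 < e -> exists2 r : R[i] -> R[i],
  finite_set (r @` [set z | normc z <= M]) &
  forall z, normc z <= M -> normc (z - r z) <= e.
Proof.
move=> e0; have := @square_compact R M; rewrite compact_cover.
move=> /(_ R[i] setT (fun c => [set z | normc (c - z) < e])) [].
- move=> c _; rewrite openE => z /= cz; apply/nbhs_normcP.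
  exists (e - normc (c - z)); first by rewrite subr_gt0.
  move=> w zw; apply: (le_lt_trans (normc_triangle _ z _)).
  by rewrite addrC -ltrBrDr.
- by move=> z _; exists z => //=; rewrite subrr normc0.
move=> D _ cov.
have /choice[r rP] z : exists c : R[i], normc z <= M -> [set` D] c /\ normc (z - c) <= e.
  have [zM|nzM] := pselect (normc z <= M); last by exists 0.
  have [c Dc /= cz] := cov z (normc_square zM).
  by exists c => _; split => //; rewrite normcB_sym ltW.
exists r; last by move=> z /rP[].
by apply: (finite_subfset D) => _ [z /rP[] + _ <-].
Qed.

End Rounding.

Section ColoringFunctions.
Context {R : realType} {L : language} {F : structure L}.
Implicit Types (A B : finsub F) (f : automorphism F -> R[i]).

Lemma coloring_fun_RUCb A (c : coloring A) : finite_coloring c ->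
  RUCb (coloring_fun c : automorphism F -> R[i]).
Proof.
move=> cfin; split.
  have [s cs] := (finite_seqP _).1 cfin.
  have cin g : coloring_fun c g \in s.
    by have : [set` s] (coloring_fun c g) by rewrite -cs; eexists.
  exists (\sum_(z <- s) normc z) => g; rewrite (big_rem _ (cin g)) /= lerDl.
  by apply: sumr_ge0 => z _; exact: normc_ge0.
move=> e e0; exists (stab A); first by apply/nbhs1_stabP; exists A.
by move=> g h /restrictVP gh; rewrite /coloring_fun gh subrr normc0.
Qed.

(** Right uniform continuity makes [f] almost constant on the right cosets of
    the stabilizer of some [A]; the copy of [A] attached to a coset gets the
    rounded value of [f] at a representative [g'] of this coset. *)
Lemma RUCb_coloring f (r : R[i] -> R[i]) (e : R) : ultrahomogeneous F ->
  RUCb f -> 0 < e -> exists A (c : coloring A),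
    (forall a, exists g, c a = r (f g)) /\
    forall g, exists2 g', coloring_fun c g = r (f g') & normc (f g - f g') < e.
Proof.
move=> uh [_ fu] e0; have [U /nbhs1_stabP[A AU] fU] := fu e e0.
have /choice[g gP] a := @emb_extends _ _ uh A a.
exists A, (fun a => r (f (g a))); split; first by move=> a; exists (g a).
move=> h; exists (g (emb_comp h^-1%g (incl A))) => //.
by apply: fU; apply: AU; apply/restrictVP; rewrite gP.
Qed.

Lemma finite_coloring_approx f (e : R) : ultrahomogeneous F -> RUCb f -> 0 < e ->
  exists A (c : coloring A), finite_coloring c /\
    forall g, normc (f g - coloring_fun c g) <= e.
Proof.
move=> uh hf e0; have e20 : 0 < e / 2 by rewrite divr_gt0.
have [[M fM] _] := hf; have [r rfin rP] := finite_rounding M e20.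
have [A [c [cr cf]]] := RUCb_coloring r uh hf e20.
exists A, c; split.
  apply: sub_finite_set rfin => _ [a _ <-]; have [g ->] := cr a.
  by exists (f g) => //=.
move=> g; have [g' -> ff'] := cf g.
by rewrite (le_trans (normc_triangle _ (f g') _)) // (splitr e) lerD ?rP // ltW.
Qed.

(** When the values of [f] are isolated from each other by [e], the function is
    exactly constant on the cosets and no rounding is needed. *)
Lemma coloring_of_discrete f (e : R) : ultrahomogeneous F -> RUCb f -> 0 < e ->
  finite_set (range f) -> (forall g g', normc (f g - f g') < e -> f g = f g') ->
  exists A (c : coloring A), finite_coloring c /\ f = coloring_fun c.
Proof.
move=> uh hf e0 ffin fdisc; have [A [c [cr cf]]] := RUCb_coloring id uh hf e0.
exists A, c; split.
  by apply: sub_finite_set ffin => _ [a _ <-]; have [g ->] := cr a; exists g.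
by apply/funext => g; have [g' -> /fdisc] := cf g.
Qed.

(** Colorings of the copies of different [A] can thus be compared inside the
    copies of one larger finite substructure. *)
Lemma coloring_fun_enlarge A A' (c : coloring A) : finsub_set A `<=` finsub_set A' ->
  finite_coloring c -> exists2 c' : coloring A',
    finite_coloring c' & coloring_fun c' = coloring_fun c :> (_ -> R[i]).
Proof.
move=> AA' cfin.
have sub x : finsub_set A' (incl A x) by apply: AA'; exact: set_mem (valP x).
exists (fun a => c (emb_comp a (corestrict sub))).
  by apply: sub_finite_set cfin => _ [a _ <-]; exists (emb_comp a (corestrict sub)).
by apply/funext => g; congr c; exact: emb_eq.
Qed.

End ColoringFunctions.

(** * Fixed points by compactness *)

Section FixedPoints.
Context {R : realType} {G : topGroupType}.

(** A point is fixed when no function of a separating family distinguishes it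
    from its translates. Each function, group element and error defines a closed
    condition, and compactness reduces to finitely many of them at a time. *)
Lemma fixed_point_of_almost_fixed (Y : flow G) (Phi : set (Y -> R[i])) :
  (forall phi, Phi phi -> continuous phi) ->
  (forall y z, (forall phi, Phi phi -> phi y = phi z) -> y = z) ->
  (forall D : set ((Y -> R[i]) * G), finite_set D -> (forall t, D t -> Phi t.1) ->
    forall e : R, 0 < e -> exists z, forall t, D t ->
      normc (t.1 (flow_act t.2 z) - t.1 z) <= e) ->
  has_fixed_point Y.
Proof.
move=> Phi_cont Phi_sep almost.
pose D : set ((Y -> R[i]) * G * R) := [set t | Phi t.1.1 /\ 0 < t.2].
pose f (t : (Y -> R[i]) * G * R) : set Y :=
  [set z | normc (t.1.1 (flow_act t.1.2 z) - t.1.1 z) <= t.2].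
have fI : finI D f.
  move=> D' D'D.
  have D'P t : [set` D'] t -> D t by move=> /D'D/set_mem.
  (* A single positive error below the finitely many ones of [D']. *)
  have [d d0 dD] : exists2 d : R, 0 < d & forall t, [set` D'] t -> d <= t.2.
    have [] := @filter_ex _ (0:R)^'+ _ (`]0, +oo[ `&`
      \bigcap_(t in [set` D']) [set d : R | d <= t.2]).
      apply: filterI.
        by near=> d => /=; rewrite in_itv /= andbT; near: d; exact: nbhs_right_gt.
      by apply: filter_bigI => t /D'P[_ t0]; exact: nbhs_right_le.
    by move=> d [/= +  dD]; rewrite in_itv /= andbT; exists d.
  have D'fin : finite_set (fst @` [set` D']) by exact: finite_image.
  have D'Phi t : (fst @` [set` D']) t -> Phi t.1 by move=> [s /D'P[Ps _] <-].
  have [z zP] := almost _ D'fin D'Phi d d0.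
  by exists z => t D't; apply: (le_trans (zP _ _)); [exists t|exact: dD].
have FF := finI_filter fI.
have [p [_ pcl]] := @flow_compact _ Y _ FF (filterT (F := filter_from (finI_from D f) id)).
exists p => g; apply: Phi_sep => phi Pphi.
apply: (@eq_of_normc_small _ _ _ 3) => // e e0.
have fte : filter_from (finI_from D f) id (f (phi, g, e)).
  by exists (f (phi, g, e)) => //; apply: finI_from1.
have cphi := Phi_cont _ Pphi.
have cg : continuous (fun z => phi (flow_act g z)).
  by move=> z; apply: (@continuous_comp _ _ _ (flow_act g) phi);
    [exact: act_cont_r|exact: cphi].
have [z [/= fz [/= gpz pz]]] := pcl _ _ fte
  (filterI (near_normc (cg p) e0) (near_normc (cphi p) e0)).
apply: (le_trans (normc_triangle _ (phi (flow_act g z)) _)).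
have -> : 3 * e = e + (e + e) by ring.
rewrite lerD ?(ltW gpz) // (le_trans (normc_triangle _ (phi z) _)) // lerD //.
by rewrite normcB_sym ltW.
Unshelve. all: by end_near. Qed.

Lemma real_complex_continuous : continuous (fun x : R => x%:C%C).
Proof.
move=> x W /nbhs_normcP[e e0 eW]; apply/nbhs_ballP; exists e => // y xy.
by apply: eW; rewrite /= subr0 expr0n addr0 sqrtr_sqr.
Qed.

(** Urysohn's lemma, a compact Hausdorff space being normal. *)
Lemma continuous_functions_separate (Y : flow G) (y z : Y) :
  (forall phi : Y -> R[i], continuous phi -> phi y = phi z) -> y = z.
Proof.
move=> yz; apply: contrapT => nyz.
have acc := hausdorff_accessible (@flow_hausdorff _ Y).
have nrm := compact_normal (@flow_hausdorff _ Y) (@flow_compact _ Y).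
have sep : uniform_separator [set y] [set z].
  apply: (@normal_completely_regular R Y nrm acc y [set z] _ nyz).
  exact: accessible_closed_set1.
have [k [kc _ ky kz]] := (uniform_separatorP (R := R) _ _).1 sep.
have := yz (fun x => (k x)%:C%C).
have -> : k y = 0 by apply: ky; exists y.
have -> : k z = 1 by apply: kz; exists z.
have kC : continuous (fun x : Y => (k x)%:C%C).
  by move=> x; apply: (continuous_comp (kc x)); exact: real_complex_continuous.
by move=> /(_ kC) [] /eqP; rewrite eq_sym oner_eq0.
Qed.

End FixedPoints.

(** * Fixed points and the Ramsey property *)

Section RamseyFixedPoints.
Context {R : realType} {L : language} {F : structure L}.
Hypothesis uh : ultrahomogeneous F.
Let G := automorphism F.
Implicit Types (A B : finsub F).

Lemma finsub_inhabited : inhabited (finsub F).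
Proof.
have [x] := carrier_inhabited F.
have x0 : [set x] !=set0 by exists x.
by constructor; exact: FinSub (finite_set1 x) x0.
Qed.

(** Given finitely many functions [phi] and group elements [h], approximate
    every [phi] along the orbit by finite colorings, all of copies of one [A],
    and apply the Ramsey property to a [B] that contains all the [h^-1 A]. It
    gives a [g] for which the colors at [h g] and at [g] are close, so the point
    [g y0] of the orbit is almost fixed for these [phi] and [h]. The set [S e]
    of colorings may depend on the error, which covers both the exact and the
    approximate Ramsey properties. *)
Lemma fixed_point_of_ramsey (Y : ambit (G := G)) (Phi : set (Y -> R[i]))
    (S : R -> set (G -> R[i])) :
  (forall phi, Phi phi -> continuous phi) ->
  (forall y z, (forall phi, Phi phi -> phi y = phi z) -> y = z) ->
  (forall e : R, 0 < e -> ramsey_upto e (S e)) ->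
  (forall phi (e : R), Phi phi -> 0 < e -> exists A (c : coloring A),
    [/\ finite_coloring c, S e (coloring_fun c) &
        forall g, normc (ambit_function phi g - coloring_fun c g) <= e]) ->
  has_fixed_point Y.
Proof.
move=> Phi_cont Phi_sep ram approx.
apply: (fixed_point_of_almost_fixed Phi_cont Phi_sep) => D Dfin DPhi e e0.
have d0 : 0 < e / 3 by rewrite divr_gt0.
have [A1] := finsub_inhabited.
have /choice[AC ACP] t : exists AC : {A : finsub F & @coloring R L F A}, D t ->
    [/\ finite_coloring (projT2 AC), S (e / 3) (coloring_fun (projT2 AC)) &
        forall g, normc (ambit_function t.1 g - coloring_fun (projT2 AC) g) <= e / 3].
  have [Dt|nDt] := pselect (D t); last by exists (existT _ A1 (fun=> 0)).
  by have [A [c cP]] := approx _ _ (DPhi _ Dt) d0; exists (existT _ A c).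
(* [A1] only makes the union non-empty when [D] is empty. *)
pose A0 := (A1 : set F) `|` \bigcup_(t in D) projT1 (AC t).
have A0fin : finite_set A0.
  rewrite finite_setU; split; first exact: finsub_finite.
  by apply: bigcup_finite => // t _; exact: finsub_finite.
have A00 : A0 !=set0 by have [x Ax] := finsub_neq0 A1; exists x; left.
pose A := FinSub A0fin A00.
have /choice[c cP] t : exists c : @coloring R L F A, D t ->
    [/\ finite_coloring c, S (e / 3) (coloring_fun c) &
        forall g, normc (ambit_function t.1 g - coloring_fun c g) <= e / 3].
  have [Dt|nDt] := pselect (D t); last by exists (fun=> 0).
  have [cfin Sc cd] := ACP t Dt.
  have sub : finsub_set (projT1 (AC t)) `<=` finsub_set A.
    by move=> x xA; right; exists t.
  by have [c' cfin' cc'] := coloring_fun_enlarge sub cfin; exists c'; rewrite cc'.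
(* The identity is added so as to compare the values at [h g] with the value at [g]. *)
pose H : set G := 1%g |` snd @` D.
have Hfin : finite_set H by rewrite finite_setU; split => //; exact: finite_image.
have [B BP] := translates_in_copy uh A Hfin.
have [|_ [t Dt <-]|b bP] := ram _ d0 A B (c @` D).
- exact: finite_image.
- by have [] := cP t Dt.
have [g gP] := BP b; exists (flow_act g (ambit_pt Y)) => t Dt.
have [a1 a1P] := gP 1%g (or_introl erefl).
have [a2 a2P] := gP t.2 (or_intror (ex_intro2 _ _ t Dt erefl)).
have [_ _ cd] := cP t Dt.
have : normc (coloring_fun (c t) (t.2 * g)%g - coloring_fun (c t) g) < e / 3.
  have := bP (c t) (ex_intro2 _ _ t Dt erefl) a2 a1.
  by rewrite a1P a2P mul1g.
rewrite -flow_actM -!/(ambit_function _ _) => hg.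
apply: (le_trans (normc_triangle _ (coloring_fun (c t) (t.2 * g)%g) _)).
have -> : e = e / 3 + (e / 3 + e / 3) by field.
apply: lerD; first exact: cd.
apply: (le_trans (normc_triangle _ (coloring_fun (c t) g) _)).
by apply: lerD; [exact: ltW|rewrite normcB_sym; exact: cd].
Qed.

Lemma filter_finite_forall (T I : Type) (D : set I) (f : I -> set T)
    (E : set_system T) : Filter E -> finite_set D ->
  (forall i, D i -> E (f i)) -> E [set x | forall i, D i -> f i x].
Proof.
elim/Pchoice: I => I in D f *.
move=> FE /finite_fsetP[D' ->] Ef.
exact: (@filter_bigI _ _ D' f E FE).
Qed.

(** Since the orbit is dense, some translate [g y0] of the distinguished point
    is so close to the fixed point [p] that the finitely many [h g y0] that
    matter for the copies of [A] in [g^-1 B] are all in [W]. *)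
Lemma copy_near_fixed_point (Y : ambit (G := G)) (p : Y) (W : set Y) A B :
  (forall g, flow_act g p = p) -> nbhs p W ->
  exists b : embedding (substr B) F,
    forall a : embedding (substr A) (substr (emb_image b)),
    exists2 k : G, W (flow_act k (ambit_pt Y)) &
      emb_comp (incl _) a = emb_comp k^-1%g (incl A).
Proof.
move=> pfix Wp; have [H Hfin HP] := copies_in_translates uh A B.
have : nbhs p [set z | forall h, H h -> W (flow_act h z)].
  apply: filter_finite_forall => // h _.
  by apply: (@act_cont_r _ Y h p W); rewrite /= pfix.
have : closure (flow_orbit (ambit_pt Y)) p by rewrite ambit_dense.
move=> /[apply] -[_ [[g _ <-] gW]].
exists (emb_comp g^-1%g (incl B)) => a; have [h Hh ha] := HP g a.
by exists (h * g)%g => //; rewrite flow_actM; exact: gW.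
Qed.

End RamseyFixedPoints.

Section ZeroDimensional.
Context {R : realType} {G : topGroupType}.
Variables (S : set (G -> R[i])) (hS : S `<=` RUCb).
Hypothesis Sfin : forall f, S f -> finite_set (range f).

Lemma finite_closed (V : set R[i]) : finite_set V -> closed V.
Proof.
by move=> Vfin; apply: compact_closed; [exact: norm_hausdorff|exact: finite_compact].
Qed.

Lemma joint_eval_range f (Sf : S f) h (z : joint_ambit hS) :
  range f (joint_eval Sf h z).
Proof.
apply: (finite_closed (Sfin Sf)) => W Wz.
have : closure (flow_orbit (ambit_pt (joint_ambit hS))) z by rewrite ambit_dense.
move=> /(_ _ (joint_eval_continuous Wz))[_ [[g _ <-] Wg]].
exists (joint_eval Sf h (flow_act g (ambit_pt (joint_ambit hS)))).
by split => //; exists (h * g)%g.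
Qed.

(** A coordinate takes on the whole ambit only the finitely many values taken by
    [f], as these form a closed set. *)
Lemma joint_eval_locally_constant f (Sf : S f) h (z : joint_ambit hS) :
  \forall y \near z, joint_eval Sf h y = joint_eval Sf h z.
Proof.
set v := joint_eval Sf h z.
have Vcl : closed (range f `\ v).
  by apply: finite_closed; apply: sub_finite_set (Sfin Sf) => x [].
have : nbhs v (~` (range f `\ v)).
  by apply: open_nbhs_nbhs; split; [exact: closed_openC|by case=> _; exact].
move=> vV; have zV : nbhs z (joint_eval (hS := hS) Sf h @^-1` (~` (range f `\ v))).
  exact: joint_eval_continuous vV.
apply: filterS zV => y yV.
by apply: contrapT => yv; apply: yV; split => //; exact: joint_eval_range.
Qed.

(** The sets on which a coordinate takes a given value are clopen, and they
    generate the topology. *)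
Lemma joint_ambit_clopen_basis : has_clopen_basis (joint_ambit hS).
Proof.
split; first by move=> U [].
move=> z.
have FF : Filter (filter_from [set U : set (joint_ambit hS) | clopen U /\ U z] id).
  apply: filter_from_filter; first by exists setT; split => //; exact: clopenT.
  by move=> U V [cU Uz] [cV Vz]; exists (U `&` V) => //; split => //; exact: clopenI.
apply: (joint_cvg FF) => f Sf h W Wz.
exists [set y | joint_eval Sf h y = joint_eval Sf h z]; last first.
  by move=> y /= yz; rewrite /= yz; exact: nbhs_singleton.
split => //; split.
  rewrite openE => y /= yz; apply: filterS (joint_eval_locally_constant Sf h y) => w /= ->.
  exact: yz.
rewrite -openC openE => y /= yz.
by apply: filterS (joint_eval_locally_constant Sf h y) => w /= ->.
Qed.

End ZeroDimensional.

(** * The equivalences for a class of flows *)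

Section RamseyEquivalences.
Context {R : realType} {L : language} {F : structure L}.
Hypothesis uh : ultrahomogeneous F.
Let G := automorphism F.
Variable X : flow G -> Prop.
Hypotheses (X_sup : closed_under_suprema X) (X_factor : closed_under_factors X).
Let A : set (G -> R[i]) := flow_algebra X.

Lemma orbit_closure_fixed_point (Y : flow G) (y : Y) :
  has_fixed_point (orbit_closure_flow y) -> has_fixed_point Y.
Proof.
by move=> [p pfix]; exists (val p) => g; exact: (congr1 val (pfix g)).
Qed.

Lemma ramsey_ramsey_upto (S : set (G -> R[i])) (e : R) :
  0 < e -> ramsey S -> ramsey_upto e S.
Proof.
move=> e0 ram A0 B C Cfin CS; have [b bP] := ram A0 B C Cfin CS.
by exists b => c Cc a a'; rewrite (bP c Cc a a') subrr normc0.
Qed.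

(** A coloring within [s < e] of the algebra is within [s] of a continuous
    function [phi] of [greatest_ambit]. Near a fixed point [p], where [phi]
    varies by less than [e - s], the colors are all within [e] of [phi p], hence
    within [2 * e] of each other. *)
Lemma ramsey_upto_of_fixed_points : (forall Y, X Y -> has_fixed_point Y) ->
  forall e : R, 0 < e -> ramsey_upto (2 * e) (fattening A e).
Proof.
move=> fix_all e e0 A0 B C Cfin CS.
have [p pfix] := fix_all _ (@greatest_ambit_in R G X X_sup).
pose Z := @greatest_ambit R G X.
have /choice[u uP] (c : coloring A0) : exists u : (Z -> R[i]) * R, C c ->
    [/\ continuous u.1, u.2 < e &
        forall g, normc (coloring_fun c g - ambit_function u.1 g) <= u.2].
  have [Cc|nCc] := pselect (C c); last by exists (fun=> 0, 0).
  have [_ [hc [a Aa ca]]] := CS c Cc.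
  have [phi cphi aphi] := (flow_algebraP X_sup X_factor a).1 Aa.
  exists (phi, supnorm (fun g => coloring_fun c g - a g)) => _; split => //= g.
  by rewrite -aphi; apply: supnorm_ge => //; exact: flow_algebra_RUCb Aa.
pose W := [set z : Z | forall c, C c ->
  normc ((u c).1 p - (u c).1 z) < e - (u c).2].
have Wp : nbhs p W.
  apply: filter_finite_forall => // c /uP[cu ue _].
  rewrite -subr_gt0 in ue; exact: (near_normc (cu p) ue).
have [b bP] := copy_near_fixed_point uh A0 B pfix Wp.
exists b => c Cc.
have near_p (a : embedding (substr A0) (substr (emb_image b))) :
    normc (c (emb_comp (incl _) a) - (u c).1 p) < e.
  have [k kW ->] := bP a; have [_ _ cu] := uP c Cc.
  apply: (le_lt_trans (normc_triangle _ (ambit_function (u c).1 k) _)).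
  rewrite -[e](subrK (u c).2) [_ - _ + _]addrC ler_ltD //; first exact: cu.
  by rewrite normcB_sym; exact: kW.
move=> a a'; apply: (le_lt_trans (normc_triangle _ ((u c).1 p) _)).
by rewrite mulr2n mulrDl mul1r ltrD // normcB_sym.
Qed.

(** The finite colorings of the algebra are continuous functions on the supremum
    of their own flows of translates. This ambit is zero-dimensional, and these
    functions are constant near a fixed point, which makes the colors equal and
    not only close. *)
Lemma ramsey_of_zero_dimensional_fixed_points :
  (forall Y, X Y -> has_clopen_basis Y -> has_fixed_point Y) -> ramsey A.
Proof.
move=> fix_all A0 B C Cfin CS.
pose S : set (G -> R[i]) := [set f | A f /\ finite_set (range f)].
have SA : S `<=` A by move=> f [].
have hS : S `<=` RUCb by move=> f /SA; exact: flow_algebra_RUCb.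
have Sfin f : S f -> finite_set (range f) by case.
pose Z := joint_ambit hS.
have XZ : X Z by exact: (joint_ambit_in hS X_sup SA).
have [p pfix] := fix_all _ XZ (joint_ambit_clopen_basis hS Sfin).
have SC (c : coloring A0) : C c -> S (coloring_fun c).
  move=> /CS[cfin Ac]; split => //.
  by apply: sub_finite_set cfin => _ [g _ <-]; exists (emb_comp g^-1%g (incl A0)).
have /choice[phi phiP] (c : coloring A0) : exists phi : Z -> R[i], C c ->
    (\forall z \near p, phi z = phi p) /\ coloring_fun c = ambit_function phi.
  have [Cc|nCc] := pselect (C c); last by exists (fun=> 0).
  exists (joint_eval (hS := hS) (SC c Cc) 1%g) => _; split.
    exact: joint_eval_locally_constant.
  by apply/funext => g; rewrite /ambit_function joint_eval_act mul1g joint_eval_pt.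
pose W := [set z : Z | forall c, C c -> phi c z = phi c p].
have Wp : nbhs p W.
  by apply: filter_finite_forall => // c /phiP[].
have [b bP] := copy_near_fixed_point uh A0 B pfix Wp.
exists b => c Cc.
have at_p (a : embedding (substr A0) (substr (emb_image b))) :
    c (emb_comp (incl _) a) = phi c p.
  have [k kW ->] := bP a; have [_ cphi] := phiP c Cc.
  by rewrite -(kW c Cc) -/(coloring_fun c k) cphi.
by move=> a a'; rewrite !at_p.
Qed.

Hypothesis X_orbit : forall Y, X Y -> exists y : Y, X (orbit_closure_flow y).

(** The distinguished point of an ambit is needed to turn continuous functions
    into functions on the group; it is found in an orbit closure that belongs to
    the class. *)
Lemma fixed_point_of_colorings (S : R -> set (G -> R[i])) :
  (forall e : R, 0 < e -> ramsey_upto e (S e)) ->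
  (forall f (e : R), A f -> 0 < e -> exists A0 (c : @coloring R L F A0),
    [/\ finite_coloring c, S e (coloring_fun c) &
        forall g, normc (f g - coloring_fun c g) <= e]) ->
  forall Y, X Y -> has_fixed_point Y.
Proof.
move=> ram approx Y /X_orbit[y Xy]; apply: (@orbit_closure_fixed_point _ y).
apply: (@fixed_point_of_ramsey R _ _ uh (orbit_ambit y)
  [set phi | continuous phi] S) => //.
- by move=> x z; exact: continuous_functions_separate.
- by move=> phi e cphi e0; apply: approx => //; exact: ambit_function_in_algebra.
Qed.

(** The halved error compensates the factor 2 of the Ramsey property;
    approximating by [e / 3] then leaves room for the strict inequality in the
    fattening. *)
Lemma fixed_points_of_ramsey_upto :
  (forall e : R, 0 < e -> ramsey_upto (2 * e) (fattening A e)) ->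
  forall Y, X Y -> has_fixed_point Y.
Proof.
move=> ram; apply: (@fixed_point_of_colorings (fun e => fattening A (e / 2))).
  move=> e e0; have e20 : 0 < e / 2 by rewrite divr_gt0.
  by have := ram _ e20; rewrite mulrC divfK.
move=> f e Af e0; have e30 : 0 < e / 3 by rewrite divr_gt0.
have [A0 [c [cfin fc]]] := finite_coloring_approx uh (flow_algebra_RUCb Af) e30.
exists A0, c; split => //; last by move=> g; rewrite (le_trans (fc g)) //; lra.
split; first exact: coloring_fun_RUCb.
exists f => //; apply: (@le_lt_trans _ _ (e / 3)); last by lra.
by apply: supnorm_le => g; rewrite normcB_sym.
Qed.

Lemma fixed_points_of_ramsey_dense : finite_colorings_dense A -> ramsey A ->
  forall Y, X Y -> has_fixed_point Y.
Proof.
move=> dense ram; apply: (@fixed_point_of_colorings (fun=> A)).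
  by move=> e e0; exact: ramsey_ramsey_upto.
move=> f e Af e0; have [A0 [c [cfin Ac fc]]] := dense f Af e e0.
exists A0, c; split => // g; apply: le_trans (ltW fc).
exact: supnorm_ge (flow_algebra_RUCb Af) (flow_algebra_RUCb Ac) g.
Qed.

Lemma clopen_indicator_continuous (T : topologicalType) (V : set T) : clopen V ->
  continuous (fun x => (`[< V x >])%:R : R[i]).
Proof.
move=> [oV cV] x W /nbhs_singleton Wx.
suff : \forall y \near x, `[< V y >] = `[< V x >].
  by apply: filterS => y /= ->.
have [Vx|nVx] := pselect (V x).
  rewrite (asboolT Vx); apply: filterS (open_nbhs_nbhs (conj oV Vx)) => y Vy.
  exact: asboolT.
rewrite (asboolF nVx).
apply: filterS (open_nbhs_nbhs (conj (closed_openC cV) nVx)) => y Vy.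
exact: asboolF.
Qed.

(** Indicators of clopen sets separate the points of a zero-dimensional flow,
    and along an orbit they are exactly finite colorings. These belong to the
    algebra, as functions of an ambit of the class, so the exact Ramsey property
    applies to them. *)
Lemma zero_dimensional_fixed_points_of_ramsey : ramsey A ->
  forall Y, X Y -> has_clopen_basis Y -> has_fixed_point Y.
Proof.
move=> ram Y /X_orbit[y Xy] [_ Ybasis].
apply: (@orbit_closure_fixed_point _ y).
pose O := orbit_ambit y.
pose ind (V : set Y) : O -> R[i] := fun x => (`[< V (set_val x) >])%:R.
have ind_cont V : clopen V -> continuous (ind V).
  move=> cV x W Wx.
  have := @set_type_continuous _ _ x _ (clopen_indicator_continuous cV Wx).
  by [].
apply: (@fixed_point_of_ramsey R _ _ uh O [set phi | exists2 V, clopen V & phi = ind V]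
  (fun=> A)).
- by move=> _ [V cV ->]; exact: ind_cont.
- move=> x z xz; suff : set_val x = set_val z by exact: val_inj.
  apply: contrapT => nxz.
  have : nbhs (set_val x : Y) (~` [set set_val z]).
    apply: open_nbhs_nbhs; split; last exact: nxz.
    apply/closed_openC/accessible_closed_set1.
    exact: (hausdorff_accessible (@flow_hausdorff _ Y)).
  move=> /Ybasis[V [cV Vx] VnZ].
  have := xz _ (ex_intro2 _ _ V cV erefl); rewrite /ind.
  rewrite (asboolT Vx); case: asboolP => [/VnZ /(_ erefl) []|_ /eqP].
  by rewrite oner_eq0.
- by move=> e e0; exact: ramsey_ramsey_upto.
- move=> _ e [V cV ->] e0.
  have Aind : A (ambit_function (ind V)).
    exact: (ambit_function_in_algebra (ind_cont V cV) X_factor Xy).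
  have rfin : finite_set (range (ambit_function (ind V))).
    apply: (@sub_finite_set _ _ (range (fun b : bool => b%:R : R[i]))).
      by move=> _ [g _ <-]; eexists.
    exact/finite_image/finite_finset.
  have [|A0 [c [cfin fc]]] := coloring_of_discrete uh (flow_algebra_RUCb Aind) ltr01 rfin.
    move=> g g'; rewrite /ambit_function /ind.
    by do 2 case: asboolP => _ //; rewrite ?subr0 ?sub0r ?normcN normc1 ltxx.
  exists A0, c; split => //; first by rewrite -fc.
  by move=> g; rewrite fc subrr normc0 ltW.
Qed.

End RamseyEquivalences.

Theorem theorem2 (R : realType) (L : language) (F : structure L)
  (F_fraisse : fraisse F) (X : flow (automorphism F) -> Prop)
  (X_sup : closed_under_suprema X) (X_factor : closed_under_factors X)
  (X_orbit : forall Y, X Y -> exists y : Y, X (orbit_closure_flow y)) :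
  let A : set (automorphism F -> R[i]) := flow_algebra X in
  let i := forall Y, X Y -> has_fixed_point Y in
  let ii := forall e : R, 0 < e -> ramsey_upto (2 * e) (fattening A e) in
  let iii := forall Y, X Y -> has_clopen_basis Y -> has_fixed_point Y in
  let iv := ramsey A in
  [/\ unital_left_invariant_closed_subCstar A,
      i <-> ii,
      iii <-> iv,
      i -> iii &
      finite_colorings_dense A -> [<-> i; ii; iii; iv]].
Proof.
have [_ uh] := F_fraisse; move=> A i ii iii iv.
have i_ii : i -> ii by exact: ramsey_upto_of_fixed_points.
have ii_i : ii -> i by exact: fixed_points_of_ramsey_upto.
have i_iii : i -> iii by move=> Hi Y /Hi.
have iii_iv : iii -> iv by exact: ramsey_of_zero_dimensional_fixed_points.
have iv_iii : iv -> iii by exact: zero_dimensional_fixed_points_of_ramsey.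
split => //; first exact: flow_algebra_subCstar.
move=> dense; tfae => // [/ii_i/i_iii //|].
exact: fixed_points_of_ramsey_dense.
Qed.
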